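(* Let $m\ge 1$, let $f:(S^1)^m\to\mathbb{C}$ be given by $f(z_1,\dots,z_m)=\sum_{j=1}^m z_j$, let $b\in\mathbb{C}$ be a regular value of $f$, and let $U\subset\mathbb{C}$ be an open set consisting of regular values of $f$ and containing $b$. The fixed points of the action of the holonomy group $\mathcal{H}_b(U)$ on $M_b$ are exactly the configurations $z=(z_1,\dots,z_m)\in M_b$ such that the sequence $z_1,\dots,z_m$ takes exactly $2$ values.
   Context: $T^m=(S^1)^m$ is the flat torus (product of unit circles in $\mathbb{C}$, product metric), and $M_b=f^{-1}(b)$. For $z\in T^m$ let $\Delta_z$ be the orthogonal complement of $\ker T_zf$ in $T_zT^m$. A horizontal curve is a piecewise smooth curve in $T^m$ whose velocity at each time lies in $\Delta$. Every piecewise smooth loop $c$ at $b$ with image in $U$ has, for every $q\in M_b$, a unique horizontal lift (a horizontal curve $\tilde c$ with $f\circ\tilde c=c$) starting at $q$. Sending $q$ to the endpoint of this lift defines a diffeomorphism of $M_b$, the holonomy of $c$. The holonomy group $\mathcal{H}_b(U)$ is the group of all diffeomorphisms of $M_b$ so obtained from piecewise smooth loops at $b$ in $U$. A fixed point of the action is a point fixed by every element of the group. *)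

(* Defs.v *)
From HB Require Import structures.
From mathcomp Require Import all_boot all_order all_algebra.
From mathcomp Require Import complex.
From mathcomp Require Import all_classical all_reals all_analysis.

Set Implicit Arguments.
Unset Strict Implicit.
Unset Printing Implicit Defensive.

Import Order.TTheory GRing.Theory Num.Theory.
Import numFieldNormedType.Exports.

Local Open Scope classical_set_scope.
Local Open Scope complex_scope.
Local Open Scope ring_scope.

Section Torus.
Context {R : realType} {m : nat}.
Local Notation C := R[i].
Local Notation V := 'rV[R[i]]_m.

(* (S^1)^m as a subset of C^m; configurations are row vectors. *)
Definition torus : set V := [set z | forall j, `|z ord0 j| = 1].

(* The formula makes sense on all of C^m; the map f of interest is its
   restriction to the torus. *)
Definition sum_map (z : V) : C := \sum_(j < m) z ord0 j.

Definition fiber (b : C) : set V := [set z | torus z /\ sum_map z = b].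

(* The Euclidean inner product of C^m = R^(2m), which induces the product
   metric on the torus. *)
Definition inner (u v : V) : R :=
  \sum_(j < m) (complex.Re (u ord0 j) * complex.Re (v ord0 j)
                + complex.Im (u ord0 j) * complex.Im (v ord0 j)).

(* T_z T^m inside C^m: the tangent line to S^1 at z_j is the real line
   orthogonal to z_j. *)
Definition tangent (z : V) : set V :=
  [set v | forall j, complex.Re (z ord0 j) * complex.Re (v ord0 j)
                     + complex.Im (z ord0 j) * complex.Im (v ord0 j) = 0].

(* T_z f is the restriction to [tangent z] of the differential of the extension
   [sum_map] of f to C^m; as [sum_map] is C-linear, its complex differential is
   also its real one. The alias R[i]^o carries the topology and norm of C. *)
Definition tangent_map (z v : V) : C :=
  'd (sum_map : 'rV[C^o]_m -> C^o) (z : 'rV[C^o]_m) v.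

Fact sum_map_linear : linear (sum_map : 'rV[C^o]_m -> C^o).
Proof.
move=> a u v; rewrite /sum_map scaler_sumr -big_split /=.
by apply: eq_bigr => j _; rewrite !mxE.
Qed.

HB.instance Definition _ := GRing.isLinear.Build C 'rV[C^o]_m C^o *:%R
  (sum_map : 'rV[C^o]_m -> C^o) sum_map_linear.

Fact sum_map_continuous : continuous (sum_map : 'rV[C^o]_m -> C^o).
Proof.
apply: (@continuous_big C^o) => [x|j _]; last exact: coord_continuous.
exact: add_continuous.
Qed.

Lemma tangent_mapE (z v : V) : tangent_map z v = \sum_(j < m) v ord0 j.
Proof. by rewrite /tangent_map diff_lin //; exact: sum_map_continuous. Qed.

Definition tangent_kernel (z : V) : set V :=
  [set v | tangent z v /\ tangent_map z v = 0].

Definition horizontal_space (z : V) : set V :=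
  [set v | tangent z v /\ forall u, tangent_kernel z u -> inner u v = 0].

(* Values outside the image of [sum_map] are regular. *)
Definition regular_value (b : C) : Prop :=
  forall z, torus z -> sum_map z = b ->
    forall w : C, exists2 v, tangent z v & tangent_map z v = w.

End Torus.
Arguments torus {R} m.
Arguments fiber {R} m b.
Arguments regular_value {R} m b.

Section Curves.
Context {R : realType}.
Local Notation C := R[i].

(* Curves are parametrized by [0, 1] and represented by total functions on R,
   whose values outside [0, 1] are irrelevant. *)

(* C^oo on A, for A open, with C regarded as R^2. *)
Definition smooth_on (A : set R) (g : R -> C) : Prop :=
  forall n t, A t ->
    derivable (derive1n n (fun s => complex.Re (g s))) t 1 /\
    derivable (derive1n n (fun s => complex.Im (g s))) t 1.

Definition velocity (g : R -> C) (t : R) : C :=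
  (derive1 (fun s => complex.Re (g s)) t)
    +i* (derive1 (fun s => complex.Im (g s)) t).

(* g is a smooth extension of the restriction of c to [s, t] to an open
   neighbourhood of [s, t]; its derivatives at s and t are the one-sided ones
   of c. *)
Definition smooth_extension (s t : R) (c g : R -> C) : Prop :=
  (exists A : set R, [/\ open A, `[s, t] `<=` A & smooth_on A g]) /\
  (forall x, s <= x <= t -> g x = c x).

(* 0 = p 0 < p 1 < ... < p k = 1 *)
Definition subdivision (k : nat) (p : nat -> R) : Prop :=
  [/\ p 0%N = 0, p k = 1 & forall i, (i < k)%N -> p i < p i.+1].

Definition piecewise_smooth (c : R -> C) : Prop :=
  exists k p, subdivision k p /\
    forall i, (i < k)%N -> exists g, smooth_extension (p i) (p i.+1) c g.

Definition loop_in (U : set C) (b : C) (c : R -> C) : Prop :=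
  [/\ piecewise_smooth c, c 0 = b, c 1 = b & forall t, 0 <= t <= 1 -> U (c t)].

Context {m : nat}.
Local Notation V := 'rV[R[i]]_m.

(* At the points of the subdivision both one-sided velocities are required to
   be horizontal. *)
Definition horizontal_curve (gam : R -> V) : Prop :=
  (forall t, 0 <= t <= 1 -> torus m (gam t)) /\
  exists k p, subdivision k p /\
    forall i, (i < k)%N -> exists g : 'I_m -> R -> C,
      (forall j,
         smooth_extension (p i) (p i.+1) (fun s => gam s ord0 j) (g j)) /\
      (forall t, p i <= t <= p i.+1 ->
         horizontal_space (gam t) (\row_j velocity (g j) t)).

Definition horizontal_lift (c : R -> C) (gam : R -> V) : Prop :=
  horizontal_curve gam /\ forall t, 0 <= t <= 1 -> sum_map (gam t) = c t.

End Curves.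

Section Holonomy.
Context {R : realType} (m : nat) (b : R[i]).
Local Notation C := R[i].
Local Notation M := (set_type (fiber m b)).

(* phi sends each q to the endpoint of the horizontal lift of c starting at q.
   Over regular values this lift exists and is unique, so that c determines phi,
   and phi is then automatically a diffeomorphism. *)
Definition is_holonomy (c : R -> C) (phi : M -> M) : Prop :=
  forall q, exists gam : R -> 'rV[C]_m,
    [/\ horizontal_lift c gam, gam 0 = \val q & gam 1 = \val (phi q)].

Definition holonomy_group (U : set C) : set (M -> M) :=
  [set phi | exists2 c, loop_in U b c & is_holonomy c phi].

Definition fixed_points (U : set C) : set M :=
  [set q | forall phi, holonomy_group U phi -> phi q = q].

End Holonomy.
Arguments fixed_points {R} m b U.

(* Main.v *)
Require Import Defs.
From HB Require Import structures.
From mathcomp Require Import all_boot all_order all_algebra.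
From mathcomp Require Import complex ring lra.
From mathcomp Require Import all_classical all_reals all_analysis.

(** At a configuration z over a regular value, the horizontal vectors are the
    vectors whose j-th entry is the projection of a vector w of the plane, the same
    for all j, to the tangent line of the circle at z_j ([horizontal_spaceE]).  On
    the circle this field is (w - conj(w) z^2) / 2, the generator of a
    one-parameter group of Moebius transformations of the disc without rotation
    part.  Horizontal transport therefore moves all coordinates by a common Moebius
    transformation.

    Suppose that q takes two values x and y.  Coordinates which are equal stay equal
    along a horizontal lift, as their distance obeys a linear differential
    inequality ([horizontal_merge]).  The lift is then a pair of points (x, y) of
    the circle with r x + s y prescribed.  There are two such pairs, mirror images of
    each other with opposite orientations, and the orientation cannot change over
    regular values.  Hence every loop leads back to (x, y): this is
    [two_values_fixed].

    Conversely, suppose that q is fixed.  The small arc rho(eta t) b from b, where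
    rho runs along the unit circle, has a horizontal lift from q.  At time t this
    lift can be continued by three Moebius boosts, which are explicit horizontal
    curves ([boost_path_lift]) and whose product is the rotation by rho(eta t)^-1
    ([boost_rotation]): a commutator of horizontal fields produces the missing
    rotation field.  The result is a loop in U, so its lift ends at q, and the lift
    of the arc is rho(eta t) q ([fixed_rotated_lift]).  So the rotation field is
    horizontal along it: a vector w has the same nonzero Euclidean product with
    i z_j for all j.  The z_j are on a line, which meets the circle in at most two
    points ([fixed_two_values]); regularity excludes a single value.

    A holonomy is defined on the whole fibre, so the second part also needs lifts of
    the same loop from the other points.  They come from a Picard theorem for
    globally Lipschitz fields ([picard]), applied in angular coordinates to the
    horizontal field regularized near the critical points ([lift_exists]). *)

Set Implicit Arguments.
Unset Strict Implicit.
Unset Printing Implicit Defensive.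

Import Order.TTheory GRing.Theory Num.Theory.
Import numFieldNormedType.Exports.

Local Open Scope classical_set_scope.
Local Open Scope complex_scope.
Local Open Scope ring_scope.

(** * Derivatives of finite order *)

Section RealDerivatives.
Context {R : realType}.
Implicit Types (f g : R -> R) (t a b : R).

Lemma is_deriveD1 f g t a b : is_derive t 1 f a -> is_derive t 1 g b ->
  is_derive t 1 (fun s => f s + g s) (a + b).
Proof. by move=> df dg; exact: is_deriveD. Qed.

Lemma is_deriveN1 f t a : is_derive t 1 f a -> is_derive t 1 (fun s => - f s) (- a).
Proof. by move=> df; exact: is_deriveN. Qed.

Lemma is_deriveB1 f g t a b : is_derive t 1 f a -> is_derive t 1 g b ->
  is_derive t 1 (fun s => f s - g s) (a - b).
Proof. by move=> df dg; exact: is_deriveB. Qed.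

Lemma is_deriveM1 f g t a b : is_derive t 1 f a -> is_derive t 1 g b ->
  is_derive t 1 (fun s => f s * g s) (a * g t + f t * b).
Proof.
move=> df dg; rewrite (_ : (fun s => _) = f * g); last exact/funext.
apply: is_derive_eq.
by rewrite addrC [g t *: a]mulrC.
Qed.

Lemma is_deriveV1 f t a : f t != 0 -> is_derive t 1 f a ->
  is_derive t 1 (fun s => (f s)^-1) (- (a * (f t)^-1 * (f t)^-1)).
Proof.
move=> f0 df; have := is_deriveV f0 df; congr is_derive.
by rewrite /GRing.scale /= expr2 invfM; ring.
Qed.

Lemma is_derive_sum1 m (f : 'I_m -> R -> R) t (d : 'I_m -> R) :
  (forall j, is_derive t 1 (f j) (d j)) ->
  is_derive t 1 (fun s => \sum_j f j s) (\sum_j d j).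
Proof.
move=> df; have := is_derive_sum df; congr (is_derive _ _ _ _).
by apply/funext => s; rewrite fct_sumE.
Qed.

Lemma is_derive_derive1 f t : derivable f t 1 -> is_derive t 1 f (derive1 f t).
Proof. by move=> df; rewrite derive1E; exact: derivableP. Qed.

Lemma derive1_is f t a : is_derive t 1 f a -> (derive1 f) t = a.
Proof. by move=> df; rewrite derive1E; exact: derive_val. Qed.

Lemma is_derive_continuous f t a : is_derive t 1 f a -> {for t, continuous f}.
Proof. by move=> [df _]; exact/differentiable_continuous/derivable1_diffP. Qed.

Lemma is_derive_unique1 f t a b :
  is_derive t 1 f a -> is_derive t 1 f b -> a = b.
Proof. by move=> /derive1_is <- /derive1_is. Qed.

(** Finite orders make inductions possible: the derivative of a product or of an
    inverse involves the functions themselves at one order less, and a solution of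
    a differential equation gains one order from the equation.  Nothing is asked at
    order 0, since derivability at the next order already gives continuity. *)
Fixpoint Ck (n : nat) (A : set R) f : Prop :=
  if n is k.+1 then (forall t, A t -> derivable f t 1) /\ Ck k A (derive1 f) else True.

Lemma Ck_ext n (A : set R) f g : open A -> (forall t, A t -> f t = g t) ->
  Ck n A f -> Ck n A g.
Proof.
move=> oA; elim: n f g => //= n IH f g fg [df Cf].
have nfg t : A t -> \near t, f t = g t.
  move=> At; have := open_nbhs_nbhs (conj oA At).
  by apply: filterS => s /fg.
split=> [t At|]; first exact: near_eq_derivable (nfg t At) (df t At).
apply: IH Cf => t At; rewrite !derive1E; exact: near_eq_derive (nfg t At).
Qed.

(** The step of every induction on the order: a function is as regular as its
    derivative, plus one. *)
Lemma Ck_derive n (A : set R) f g : open A ->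
  (forall t, A t -> is_derive t 1 f (g t)) -> Ck n A g -> Ck n.+1 A f.
Proof.
move=> oA df Cg; split; first by move=> t /df [].
by apply: Ck_ext oA _ Cg => t At; rewrite (derive1_is (df t At)).
Qed.

Lemma Ck_is_derive n (A : set R) f t : Ck n.+1 A f -> A t ->
  is_derive t 1 f (derive1 f t).
Proof. by move=> [df _] At; exact/is_derive_derive1/df. Qed.

Lemma CkS n (A : set R) f : Ck n.+1 A f -> Ck n A f.
Proof.
elim: n f => //= n IH f [df [ddf Cf]]; split=> //.
by apply: IH; split.
Qed.

Lemma Ck_cst n (A : set R) a : Ck n A (fun=> a).
Proof.
elim: n a => //= n IH a; split=> [t _|]; first exact: derivable_cst.
by rewrite (_ : derive1 _ = fun=> 0) //; apply/funext => t; rewrite derive1_cst.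
Qed.

Lemma Ck_id n (A : set R) : open A -> Ck n A id.
Proof.
case: n => // n oA; apply: (Ck_derive oA (g := fun=> 1)); exact: Ck_cst.
Qed.

Lemma CkD n (A : set R) f g : open A -> Ck n A f -> Ck n A g ->
  Ck n A (fun t => f t + g t).
Proof.
move=> oA; elim: n f g => // n IH f g Cf Cg.
apply: (Ck_derive oA) => [t At|].
  by apply: is_deriveD1; apply: Ck_is_derive At; eassumption.
by apply: IH; [case: Cf | case: Cg].
Qed.

Lemma CkM n (A : set R) f g : open A -> Ck n A f -> Ck n A g ->
  Ck n A (fun t => f t * g t).
Proof.
move=> oA; elim: n f g => // n IH f g Cf Cg.
apply: (Ck_derive oA) => [t At|].
  by apply: is_deriveM1; apply: Ck_is_derive At; eassumption.
by apply: CkD => //; apply: IH; solve [exact: CkS | case: Cf => // | case: Cg => //].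
Qed.

Lemma CkN n (A : set R) f : open A -> Ck n A f -> Ck n A (fun t => - f t).
Proof.
move=> oA Cf; apply: (Ck_ext (f := fun t => -1 * f t) oA) => [t _|].
  by rewrite mulN1r.
by apply: CkM => //; exact: Ck_cst.
Qed.

Lemma CkB n (A : set R) f g : open A -> Ck n A f -> Ck n A g ->
  Ck n A (fun t => f t - g t).
Proof. by move=> oA Cf Cg; apply: CkD => //; exact: CkN. Qed.

Lemma CkV n (A : set R) f : open A -> (forall t, A t -> f t != 0) ->
  Ck n A f -> Ck n A (fun t => (f t)^-1).
Proof.
move=> oA f0; elim: n => // n IH Cf.
apply: (Ck_derive oA) => [t At|].
  by apply: is_deriveV1; [exact: f0 | exact: Ck_is_derive Cf At].
have CV := IH (CkS Cf).
by do ![apply: CkN | apply: CkM] => //; case: Cf.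
Qed.

Lemma Ck_sum n (A : set R) m (f : 'I_m -> R -> R) : open A ->
  (forall j, Ck n A (f j)) -> Ck n A (fun t => \sum_j f j t).
Proof.
move=> oA; elim: n f => // n IH f Cf.
apply: (Ck_derive oA) => [t At|].
  by apply: is_derive_sum1 => j; exact: Ck_is_derive (Cf j) At.
by apply: IH => j; case: (Cf j).
Qed.

(** The derivative of each of the two functions is a multiple of the other one, so
    both are treated in the same induction. *)
Lemma Ck_cos_sin n (A : set R) f : open A -> Ck n A f ->
  Ck n A (fun t => cos (f t)) /\ Ck n A (fun t => sin (f t)).
Proof.
move=> oA; elim: n => // n IH Cf.
have [Cc Cs] := IH (CkS Cf); have Cdf : Ck n A (derive1 f) by case: Cf.
have df t : A t -> is_derive t 1 f (derive1 f t) by exact: Ck_is_derive Cf.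
split.
- apply: (Ck_derive oA) => [t At|].
    exact: (@is_derive1_comp _ (@cos R) f _ _ _ (is_derive_cos _) (df t At)).
  by apply: CkM => //; exact: CkN.
- apply: (Ck_derive oA) => [t At|].
    exact: (@is_derive1_comp _ (@sin R) f _ _ _ (is_derive_sin _) (df t At)).
  exact: CkM.
Qed.

Lemma is_derive_affine t a b : is_derive t 1 (fun s => a * s + b) a.
Proof.
have := is_deriveD1 (is_deriveM1 (is_derive_cst a t 1) (is_derive_id t 1))
  (is_derive_cst b t 1).
by congr is_derive; rewrite mul0r add0r addr0 mulr1.
Qed.

Lemma is_derive_comp_affine f t a b d : is_derive (a * t + b) 1 f d ->
  is_derive t 1 (fun s => f (a * s + b)) (a * d).
Proof.
move=> df; have := is_derive_affine t a b => da.
by rewrite mulrC; exact: (@is_derive1_comp _ f (fun s => a * s + b) _ _ _ df da).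
Qed.

Lemma open_affine (A : set R) a b : open A -> open [set t | A (a * t + b)].
Proof.
move=> oA; apply: (open_comp (f := fun s : R => a * s + b)) oA => t _.
exact: is_derive_continuous (is_derive_affine t a b).
Qed.

Lemma Ck_affine n (A : set R) f a b : open A -> Ck n A f ->
  Ck n [set t | A (a * t + b)] (fun t => f (a * t + b)).
Proof.
move=> oA; elim: n f => // n IH f Cf.
apply: (Ck_derive (open_affine oA)) => [t At|].
  by apply: is_derive_comp_affine; exact: Ck_is_derive Cf At.
apply: CkM; [exact: open_affine|exact: Ck_cst|apply: IH].
by case: Cf.
Qed.

Lemma Ck_derive1n n (A : set R) f : Ck n.+1 A f ->
  forall t, A t -> derivable (derive1n n f) t 1.
Proof. by elim: n f => [|n IH] f [df Cf] //; rewrite derive1Sn; exact: IH. Qed.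

Lemma derive1n_Ck (A : set R) f :
  (forall n t, A t -> derivable (derive1n n f) t 1) -> forall n, Ck n A f.
Proof.
move=> df n; elim: n f df => //= n IH f df; split; first exact: (df 0).
by apply: IH => k t At; rewrite -derive1Sn; exact: df.
Qed.

Lemma Ck_sub n (A B : set R) f : A `<=` B -> Ck n B f -> Ck n A f.
Proof.
move=> AB; elim: n f => //= n IH f [df Cf]; split; last exact: IH.
by move=> t /AB /df.
Qed.

End RealDerivatives.

(** * Primitives and the Gronwall estimate *)

Section RealAnalysis.
Context {R : realType}.
Implicit Types (f g u : R -> R) (t s a b : R).

Lemma is_derive_le f df a b : a <= b ->
  (forall t, a <= t <= b -> is_derive t 1 f (df t)) ->
  (forall t, a <= t <= b -> 0 <= df t) -> f a <= f b.
Proof.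
move=> ab fd df0.
have sub x : x \in `]a, b[%R -> a <= x <= b.
  by rewrite in_itv /= => /andP[/ltW -> /ltW ->].
apply: (@ger0_derive1_ndecr R f a b) => // [x /sub xab|x /sub xab|].
- by case: (fd x xab).
- by rewrite (derive1_is (fd x xab)) df0.
- apply: continuous_in_subspaceT => x; rewrite inE /= in_itv /= => xab.
  exact: is_derive_continuous (fd x xab).
Qed.

Lemma is_derive_expRM a t : is_derive t 1 (fun s => expR (a * s)) (a * expR (a * t)).
Proof.
have da : is_derive t 1 (fun s => a * s + 0) a := is_derive_affine t a 0.
have := @is_derive1_comp _ (@expR R) (fun s => a * s + 0) t _ _ (is_derive_expR _) da.
rewrite addr0 mulrC; congr is_derive; apply/funext => s /=.
by rewrite addr0.
Qed.

(** The function exp(- C t) u(t) is nonincreasing, nonnegative, and starts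
    at 0. *)
Lemma gronwall0 u du a b C :
  (forall t, a <= t <= b -> is_derive t 1 u (du t)) ->
  (forall t, a <= t <= b -> 0 <= u t) ->
  (forall t, a <= t <= b -> `|du t| <= C * u t) ->
  u a = 0 -> forall t, a <= t <= b -> u t = 0.
Proof.
move=> ud u0 duC ua t /andP[at_ tb]; apply/eqP; rewrite eq_le u0 ?at_ // andbT.
have sub s : a <= s <= t -> a <= s <= b.
  by move=> /andP[-> /le_trans]; apply.
have : - (expR (- C * a) * u a) <= - (expR (- C * t) * u t).
  apply: (is_derive_le (f := fun s => - (expR (- C * s) * u s))
    (df := fun s => - ((- C * expR (- C * s)) * u s +
      expR (- C * s) * du s)) at_) => s /sub sab.
    apply: is_deriveN1; apply: is_deriveM1; last exact: ud.
    exact: is_derive_expRM.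
  have -> : - (- C * expR (- C * s) * u s + expR (- C * s) * du s) =
      expR (- C * s) * (C * u s - du s) by ring.
  rewrite mulr_ge0 ?expR_ge0 // subr_ge0.
  by apply: le_trans (duC s sab); exact: ler_norm.
by rewrite ua mulr0 oppr0 oppr_ge0 pmulr_rle0 // expR_gt0.
Qed.

Lemma is_derive_eq_cst f g df a b : a <= b ->
  (forall t, a <= t <= b -> is_derive t 1 f (df t)) ->
  (forall t, a <= t <= b -> is_derive t 1 g (df t)) -> f b - g b = f a - g a.
Proof.
move=> ab fd gd; apply/eqP; rewrite eq_le; apply/andP; split.
  rewrite -lerN2; apply: (is_derive_le (f := fun t => - (f t - g t))
    (df := fun t => - (df t - df t))) => // t tab; last by rewrite subrr oppr0.
  by apply: is_deriveN1; apply: is_deriveB1; [exact: fd|exact: gd].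
apply: (is_derive_le (f := fun t => f t - g t)
    (df := fun t => df t - df t)) => // t tab; last by rewrite subrr.
by apply: is_deriveB1; [exact: fd|exact: gd].
Qed.

Lemma primitive_bounded f (K : R) : 0 < K -> continuous f ->
  exists F, F 0 = 0 /\ forall t, `|t| < K -> is_derive t 1 F (f t).
Proof.
move=> K0 cf.
pose I x := (\int[@lebesgue_measure R]_(t in [set` Interval (BLeft (- K)) (BRight x)]) (f t))%R.
exists (fun x => I x - I 0); rewrite subrr; split=> // t.
rewrite ltr_norml => /andP[Kt tK].
have [dI I'] : derivable I t 1 /\ derive1 I t = f t.
  apply: (@continuous_FTC1 R f (BLeft (- K)) t K) => //; last exact: cf.
  apply: continuous_compact_integrable; first exact: segment_compact.
  exact: continuous_subspaceT.
rewrite -[f t]subr0 -I'; apply: is_deriveB1; first exact: is_derive_derive1.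
Qed.

(** Primitives on bounded intervals which vanish at 0 agree where both are defined;
    the global primitive takes at x the value of the one on an interval whose size
    depends on x. *)
Lemma primitive f : continuous f ->
  exists F, F 0 = 0 /\ forall t, is_derive t 1 F (f t).
Proof.
move=> cf.
have /choice [P PP] : forall n : nat, exists F, F 0 = 0 /\
    forall t, `|t| < n.+2%:R -> is_derive t 1 F (f t).
  by move=> n; exact: primitive_bounded.
have PE k n x : (k <= n)%N -> `|x| < k.+1%:R -> P k x = P n x.
  move=> kn xk.
  have dk t : `|t| <= `|x| -> is_derive t 1 (P k) (f t).
    by move=> tx; apply: (PP k).2; apply: le_lt_trans tx (lt_trans xk _); rewrite ltr_nat.
  have dn t : `|t| <= `|x| -> is_derive t 1 (P n) (f t).
    by move=> tx; apply: (PP n).2; apply: le_lt_trans tx (lt_le_trans xk _); rewrite ler_nat leqW.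
  have [x0|x0] := leP 0 x.
    have /= := @is_derive_eq_cst (P k) (P n) f 0 x x0.
    rewrite (PP k).1 (PP n).1 subrr => H; apply/eqP; rewrite -subr_eq0; apply/eqP/H => t /andP[t0 tx].
      by apply: dk; rewrite !ger0_norm.
    by apply: dn; rewrite !ger0_norm.
  have /= := @is_derive_eq_cst (P k) (P n) f x 0 (ltW x0).
  rewrite (PP k).1 (PP n).1 subrr => H; apply/eqP; rewrite -subr_eq0; apply/eqP/esym/H => t /andP[tx t0].
    by apply: dk; rewrite !ler0_norm ?lerN2 // ltW.
  by apply: dn; rewrite !ler0_norm ?lerN2 // ltW.
exists (fun x => P (Num.truncn `|x|) x); split; first exact: (PP _).1.
move=> t; set N := Num.truncn `|t|.
have tN : `|t| < N.+1%:R by rewrite /N truncnS_gt.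
apply: (@near_eq_is_derive _ _ _ (P N)); last first.
  by apply: (PP N).2; apply: lt_trans tN _; rewrite ltr_nat.
have : nbhs t [set x : R | `|x| < N.+1%:R].
  apply/nbhs_ballP; exists (N.+1%:R - `|t|); first by rewrite /= subr_gt0.
  move=> x; rewrite /ball /= ltrBrDl; apply: le_lt_trans.
  by rewrite -[X in `|X| <= _](subKr t) ler_normB.
apply: filterS => x /= xN; apply/esym/PE; last by rewrite truncnS_gt.
by rewrite -ltnS -(ltr_nat R); apply: le_lt_trans xN; rewrite truncn_le.
Qed.

End RealAnalysis.

(** * Differential equations with a globally Lipschitz field *)

Section Picard.
Context {R : realType}.

Lemma geometric_le0 (x C : R) : (forall n : nat, x <= C / 2 ^+ n) -> x <= 0.
Proof.
move=> xC; rewrite leNgt; apply/negP => x0.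
have C0 : 0 < C by have := xC 0; rewrite expr0 divr1; exact: lt_le_trans.
pose n := Num.truncn (C / x).
have := truncnS_gt (C / x); rewrite -/n ltr_pdivrMr // => Cn.
have := xC n; rewrite ler_pdivlMr ?exprn_gt0 // leNgt => /negP; apply.
apply: lt_le_trans Cn _; rewrite mulrC ler_pM2l // -natrX ler_nat.
exact: ltn_expl.
Qed.

(** With r n := 2 C / 2 ^ n, the sequence u - r is nondecreasing, u + r is
    nonincreasing, and the limit is the supremum of the former. *)
Lemma geometric_cvg (u : nat -> R) (C : R) :
  (forall n, `|u n.+1 - u n| <= C / 2 ^+ n) ->
  exists l, forall n, `|u n - l| <= 2 * C / 2 ^+ n.
Proof.
move=> uC; pose r n := 2 * C / 2 ^+ n.
have rS n : r n.+1 = r n - C / 2 ^+ n.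
  rewrite /r exprS; field; by rewrite expf_neq0.
have C0 : 0 <= C by have := uC 0; rewrite expr0 divr1; exact: le_trans.
have r0 n : 0 <= r n by rewrite /r divr_ge0 ?mulr_ge0 ?exprn_ge0.
have low : {homo (fun n => u n - r n) : n k / (n <= k)%N >-> n <= k}.
  apply: homo_leq => [//|x y z|n]; first exact: le_trans.
  by rewrite rS; have := uC n; rewrite ler_norml => /andP[]; lra.
have up : {homo (fun n => - (u n + r n)) : n k / (n <= k)%N >-> n <= k}.
  apply: homo_leq => [//|x y z|n]; first exact: le_trans.
  by rewrite rS; have := uC n; rewrite ler_norml => /andP[]; lra.
have lu n k : u n - r n <= u k + r k.
  have := low n (maxn n k) (leq_maxl _ _).
  have := up k (maxn n k) (leq_maxr _ _).
  have := r0 (maxn n k); lra.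
have bnd k : ubound (range (fun n => u n - r n)) (u k + r k).
  by move=> _ [n _ <-].
exists (sup (range (fun n => u n - r n))) => n; rewrite -/(r n) ler_norml.
have : u n - r n <= sup (range (fun n => u n - r n)).
  apply: ub_le_sup; last by exists n.
  by exists (u 0 + r 0).
have : sup (range (fun n => u n - r n)) <= u n + r n.
  by apply: ge_sup; [exists (u 0 - r 0), 0|exact: bnd].
by lra.
Qed.

Lemma is_derive_exp_le (F f : R -> R) (K l t : R) : 0 <= t -> 0 < l -> 0 <= K ->
  F 0 = 0 -> (forall s, 0 <= s <= t -> is_derive s 1 F (f s)) ->
  (forall s, 0 <= s <= t -> f s <= K * expR (l * s)) ->
  F t <= K / l * expR (l * t).
Proof.
move=> t0 l0 K0 F0 dF fK.
have : K / l * expR (l * 0) - F 0 <= K / l * expR (l * t) - F t.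
  apply: (is_derive_le (f := fun s => K / l * expR (l * s) - F s)
    (df := fun s => (0 * expR (l * s) + K / l * (l * expR (l * s))) - f s) t0) => s st.
    apply: is_deriveB1; last exact: dF.
    exact: is_deriveM1 (is_derive_cst _ _ _) (is_derive_expRM _ _).
  rewrite mul0r add0r mulrA divfK ?gt_eqF // subr_ge0; exact: fK.
rewrite mulr0 expR0 F0 mulr1 subr0 => H.
have Kl : 0 <= K / l by rewrite divr_ge0 // ltW.
lra.
Qed.

(** Integration divides a bound that grows like exp(l |t|) by l.  For l twice the
    Lipschitz constant of a field, this makes the Picard iteration contract by 1/2
    on the whole line, so that no gluing of local solutions is needed. *)
Lemma is_derive_exp_norm (F f : R -> R) (K l : R) : 0 < l ->
  F 0 = 0 -> (forall s : R, is_derive s 1 F (f s)) ->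
  (forall s, `|f s| <= K * expR (l * `|s|)) ->
  forall t, `|F t| <= K / l * expR (l * `|t|).
Proof.
move=> l0.
have K0 (g : R -> R) : (forall s, `|g s| <= K * expR (l * `|s|)) -> 0 <= K.
  by move=> /(_ 0); rewrite normr0 mulr0 expR0 mulr1; apply: le_trans.
wlog suff H : / forall F f : R -> R, F 0 = 0 -> (forall s : R, is_derive s 1 F (f s)) ->
    (forall s, `|f s| <= K * expR (l * `|s|)) ->
    forall t, 0 <= t -> `|F t| <= K / l * expR (l * `|t|).
  move=> F0 dF fK t; have [|t0] := leP 0 t; first exact: H fK _.
  have := @H (fun s => F (-1 * s + 0)) (fun s => -1 * f (-1 * s + 0)) _ _ _ (- t) _.
  rewrite (_ : -1 * - t + 0 = t) ?normrN; last by rewrite mulN1r opprK addr0.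
  apply.
  - by rewrite mulr0 addr0.
  - by move=> s; exact: is_derive_comp_affine.
  - by move=> s; rewrite !mulN1r addr0 normrN; have := fK (- s); rewrite normrN.
  - by rewrite oppr_ge0 ltW.
move=> {}F {}f F0 dF fK t t0; rewrite ler_norml lerNl; apply/andP; split.
  rewrite (ger0_norm t0).
  apply: (@is_derive_exp_le (fun s => - F s) (fun s => - f s)) => //.
  - exact: K0 fK.
  - by rewrite F0 oppr0.
  - move=> s /andP[s0 _]; rewrite -[s in expR (_ * s)](ger0_norm s0).
    by apply: le_trans (fK s); rewrite -normrN ler_norm.
rewrite (ger0_norm t0).
apply: (@is_derive_exp_le F f) => //.
- exact: K0 fK.
- move=> s /andP[s0 _]; rewrite -[s in expR (_ * s)](ger0_norm s0).
  by apply: le_trans (fK s); rewrite ler_norm.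
Qed.

Lemma is_derive_lipschitz (F f : R -> R) (B : R) :
  (forall s : R, is_derive s 1 F (f s)) -> (forall s, `|f s| <= B) ->
  forall s t, `|F t - F s| <= B * `|t - s|.
Proof.
move=> dF fB.
have H s t : s <= t -> `|F t - F s| <= B * `|t - s|.
  move=> st; rewrite [`|t - s|]ger0_norm ?subr_ge0 // ler_norml.
  have : B * s + 0 - F s <= B * t + 0 - F t.
    apply: (is_derive_le (f := fun s => B * s + 0 - F s) (df := fun s => B - f s)) => // x _.
      exact: is_deriveB1 (is_derive_affine _ _ _) (dF _).
    by rewrite subr_ge0; apply: le_trans (fB x); exact: ler_norm.
  have : B * s + 0 + F s <= B * t + 0 + F t.
    apply: (is_derive_le (f := fun s => B * s + 0 + F s) (df := fun s => B + f s)) => // x _.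
      exact: is_deriveD1 (is_derive_affine _ _ _) (dF _).
    by rewrite -lerBlDr sub0r; apply: le_trans (fB x); rewrite -normrN ler_norm.
  lra.
move=> s t; have [|/ltW] := leP s t; first exact: H.
by move=> /H; rewrite distrC [`|s - t|]distrC.
Qed.

Lemma lipschitz_continuous (f : R -> R) (B : R) :
  (forall s t, `|f t - f s| <= B * `|t - s|) -> continuous f.
Proof.
move=> fB x; apply/cvgrPdist_lt => e e0.
have B0 : 0 <= B.
  by have := fB 0 1; rewrite subr0 normr1 mulr1; exact: le_trans.
have d0 : 0 < e / (B + 1) by rewrite divr_gt0 // ltr_wpDl.
near=> y.
apply: le_lt_trans (fB y x) _.
have : `|x - y| < e / (B + 1).
  near: y; apply/nbhs_ballP; exists (e / (B + 1)) => //.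
rewrite ltr_pdivlMr ?ltr_wpDl // => H.
have := normr_ge0 (x - y).
nra.
Unshelve. all: by end_near. Qed.

(** The Picard iterates converge geometrically for the weight exp(2 L |t|).  They
    have the common Lipschitz constant |B|, which makes their limit continuous; the
    limit is then a fixed point of the integral operator by the same weighted
    estimate.  The field is given on tuples of functions rather than on a normed
    space, and its continuity is only used along continuous curves. *)
Lemma picard m (F : 'I_m -> R -> ('I_m -> R) -> R) (B L : R) (x0 : 'I_m -> R) :
  0 < L ->
  (forall th : 'I_m -> R -> R, (forall j, continuous (th j)) ->
    forall j, continuous (fun t => F j t (fun k => th k t))) ->
  (forall j t x, `|F j t x| <= B) ->
  (forall j t x y (d : R), (forall k, `|x k - y k| <= d) ->
    `|F j t x - F j t y| <= L * d) ->
  exists th : 'I_m -> R -> R, (forall j, th j 0 = x0 j) /\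
    forall j (t : R), is_derive t 1 (th j) (F j t (fun k => th k t)).
Proof.
move=> L0 Fc FB FL.
have /choice [P PP] : forall f : R -> R, exists G : R -> R, continuous f ->
    G 0 = 0 /\ forall t : R, is_derive t 1 G (f t).
  move=> f; have [/primitive [G GP]|nf] := pselect (continuous f).
    by exists G.
  by exists f.
pose step th j t := x0 j + P (fun s => F j s (fun k => th k s)) t.
pose it n := iter n step (fun j _ => x0 j).
have dstep th : (forall j, continuous (th j)) -> forall j (t : R),
    is_derive t 1 (step th j) (F j t (fun k => th k t)).
  move=> cth j t; rewrite -[F _ _ _]add0r; apply: is_deriveD1.
  by apply: (PP _ _).2; exact: Fc.
have cit n j : continuous (it n j).
  elim: n j => [|n IH] j; first exact: cst_continuous.
  move=> t; exact: is_derive_continuous (dstep _ IH j t).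
have dit n j t := dstep (it n) (cit n) j t.
have step0 th j : (forall j, continuous (th j)) -> step th j 0 = x0 j.
  by move=> cth; rewrite /step (PP _ _).1 ?addr0 //; exact: Fc.
have it0 n j : it n j 0 = x0 j.
  by case: n => [//|n]; exact: (step0 (it n) j (cit n)).
pose l := 2 * L; have l0 : 0 < l by rewrite mulr_gt0.
pose E (t : R) : R := expR (l * `|t|).
have E1 t : 1 <= E t by rewrite /E -expR0 ler_expR mulr_ge0 // ltW.
pose K := `|B| / l.
have est n j t : `|it n.+1 j t - it n j t| <= K / 2 ^+ n * E t.
  elim: n j t => [|n IH] j t.
    rewrite expr0 divr1; apply: (@is_derive_exp_norm (fun t => it 1 j t - it 0 j t)
      (fun t => F j t (fun k => it 0 k t) - 0)) => //.
    - by rewrite !it0 subrr.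
    - move=> s; rewrite subr0; apply: le_trans (FB _ _ _) _.
      by apply: le_trans (ler_norm _) _; rewrite ler_peMr //; exact: E1.
  have -> : K / 2 ^+ n.+1 = L * (K / 2 ^+ n) / l.
    by rewrite /l exprS; field; rewrite expf_neq0 // gt_eqF.
  apply: (@is_derive_exp_norm (fun t => it n.+2 j t - it n.+1 j t)
    (fun t => F j t (fun k => it n.+1 k t) - F j t (fun k => it n k t))) => //.
  - by rewrite !it0 subrr.
  - move=> s; rewrite -mulrA; apply: FL => k; exact: IH.
have /choice [th1 H1] : forall jt : 'I_m * R, exists x, forall n,
    `|it n jt.1 jt.2 - x| <= 2 * (K * E jt.2) / 2 ^+ n.
  move=> [j t] /=; apply: geometric_cvg => n.
  by rewrite [leRHS]mulrAC; exact: est.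
pose th j t := th1 (j, t).
have lim n j t : `|it n j t - th j t| <= 2 * (K * E t) / 2 ^+ n by exact: (H1 (j, t)).
have lip n j s t : `|it n j t - it n j s| <= `|B| * `|t - s|.
  case: n => [|n]; first by rewrite subrr normr0 mulr_ge0.
  apply: is_derive_lipschitz (dit n j) _ s t => u.
  by apply: le_trans (FB _ _ _) (ler_norm _).
have cth j : continuous (th j).
  apply: (@lipschitz_continuous _ `|B|) => s t.
  rewrite -subr_le0; apply: (@geometric_le0 _ (2 * (K * E t) + 2 * (K * E s))) => n.
  rewrite mulrDl; have := lim n j t; have := lim n j s; have := lip n j s t.
  set a := it n j t; set b := it n j s.
  have -> : th j t - th j s = - (a - th j t) + (b - th j s) + (a - b) by ring.
  have := ler_normD (- (a - th j t) + (b - th j s)) (a - b).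
  have := ler_normD (- (a - th j t)) (b - th j s).
  rewrite normrN; lra.
have thE j t : step th j t = th j t.
  apply/eqP; rewrite -subr_eq0 -normr_le0.
  apply: (@geometric_le0 _ (2 * K * E t)) => n.
  have : `|step th j t - it n.+1 j t| <= L * (2 * K / 2 ^+ n) / l * E t.
    apply: (@is_derive_exp_norm (fun t => step th j t - it n.+1 j t)
      (fun t => F j t (fun k => th k t) - F j t (fun k => it n k t))) => //.
    - by rewrite it0 step0 ?subrr.
    - by move=> s; exact: is_deriveB1 (dstep th cth j s) (dit n j s).
    - move=> s; rewrite -mulrA; apply: FL => k; rewrite distrC.
      apply: le_trans (lim _ _ _) _; rewrite -/(E s).
      by have -> : 2 * K / 2 ^+ n * E s = 2 * (K * E s) / 2 ^+ n by ring.
  have -> : L * (2 * K / 2 ^+ n) / l * E t = (2 * K * E t / 2 ^+ n) / 2.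
    by rewrite /l; field; rewrite expf_neq0 // gt_eqF.
  have := lim n.+1 j t.
  have -> : 2 * (K * E t) / 2 ^+ n.+1 = (2 * K * E t / 2 ^+ n) / 2.
    by rewrite exprS; field; rewrite expf_neq0.
  have := ler_normD (step th j t - it n.+1 j t) (it n.+1 j t - th j t).
  rewrite addrA subrK; lra.
exists th; split=> [j|j t]; first by rewrite -thE step0.
have thj : step th j = th j by apply/funext => s; exact: thE.
by rewrite -thj; exact: dstep.
Qed.

End Picard.

(** * Horizontal vectors *)

Section Horizontal.
Context {R : realType} {m : nat}.
Local Notation C := R[i].
Local Notation V := 'rV[R[i]]_m.
Local Notation Re := complex.Re.
Local Notation Im := complex.Im.

Lemma complexP (u v : C) : Re u = Re v -> Im u = Im v -> u = v.
Proof. by case: u v => [a b] [c d] /= -> ->. Qed.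

Lemma complex_ReD (u v : C) : Re (u + v) = Re u + Re v. Proof. by case: u v => [a b] [c d]. Qed.
Lemma complex_ImD (u v : C) : Im (u + v) = Im u + Im v. Proof. by case: u v => [a b] [c d]. Qed.
Lemma complex_ReN (u : C) : Re (- u) = - Re u. Proof. by case: u. Qed.
Lemma complex_ImN (u : C) : Im (- u) = - Im u. Proof. by case: u. Qed.
Lemma complex_ReM (u v : C) : Re (u * v) = Re u * Re v - Im u * Im v.
Proof. by case: u v => [a b] [c d]. Qed.
Lemma complex_ImM (u v : C) : Im (u * v) = Re u * Im v + Im u * Re v.
Proof. by case: u v => [a b] [c d]. Qed.

Lemma complex_Re_sum n (f : 'I_n -> C) : Re (\sum_j f j) = \sum_j Re (f j).
Proof. exact: (big_morph (@complex.Re R) complex_ReD (erefl _)). Qed.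
Lemma complex_Im_sum n (f : 'I_n -> C) : Im (\sum_j f j) = \sum_j Im (f j).
Proof. exact: (big_morph (@complex.Im R) complex_ImD (erefl _)). Qed.

Lemma normc_eq1 (u : C) : `|u| = 1 <-> Re u ^+ 2 + Im u ^+ 2 = 1.
Proof.
split=> [u1|u1].
  by have := add_Re2_Im2 u; rewrite u1 expr1n => /complexI.
by rewrite normc_def u1 sqrtr1.
Qed.

Definition det2 (u v : C) : R := Re u * Im v - Re v * Im u.

(** The determinant of the matrix of the differential of the sum map times its
    transpose; it vanishes exactly at the configurations whose entries are pairwise
    parallel, that is, at the critical points. *)
Definition gram (z : V) : R :=
  (\sum_j Re (z ord0 j) ^+ 2) * (\sum_j Im (z ord0 j) ^+ 2) -
  (\sum_j Re (z ord0 j) * Im (z ord0 j)) ^+ 2.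

(** Lagrange's identity. *)
Lemma gramE (z : V) :
  2 * gram z = \sum_j \sum_k det2 (z ord0 j) (z ord0 k) ^+ 2.
Proof.
pose x j := Re (z ord0 j); pose y j := Im (z ord0 j).
transitivity (\sum_j \sum_k (x j ^+ 2 * y k ^+ 2 + y j ^+ 2 * x k ^+ 2 -
    2 * (x j * y j) * (x k * y k))); last first.
  by apply: eq_bigr => j _; apply: eq_bigr => k _; rewrite /det2 -/(x j) -/(y j); ring.
under eq_bigr => j _ do rewrite sumrB big_split /= -!mulr_sumr -mulrA.
rewrite sumrB big_split /= -!mulr_suml -mulr_sumr -!mulr_suml.
by rewrite /gram; ring.
Qed.

Lemma gram_ge0 (z : V) : 0 <= gram z.
Proof.
rewrite -(pmulr_rge0 _ (ltr0n R 2)) gramE.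
by apply: sumr_ge0 => j _; apply: sumr_ge0 => k _; exact: sqr_ge0.
Qed.

Lemma gram_eq0 (z : V) : gram z = 0 -> forall j k, det2 (z ord0 j) (z ord0 k) = 0.
Proof.
move=> z0 j k; have := gramE z; rewrite z0 mulr0 => /esym/eqP.
rewrite psumr_eq0 => [/allP /(_ j (mem_index_enum j))|i _]; last first.
  by apply: sumr_ge0 => ? _; exact: sqr_ge0.
rewrite psumr_eq0 => [/allP /(_ k (mem_index_enum k))|i _]; last exact: sqr_ge0.
by rewrite /= sqrf_eq0 => /eqP.
Qed.

Lemma gram_neq0 (z : V) : gram z != 0 -> exists j k, det2 (z ord0 j) (z ord0 k) != 0.
Proof.
move=> z0; apply: contrapT => nz; move: z0; have /eqP := gramE z.
rewrite [X in _ == X]big1 => [|j _]; last first.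
  rewrite big1 // => k _; apply/eqP; rewrite sqrf_eq0.
  by apply/negPn/negP => d; apply: nz; exists j, k.
by rewrite mulf_eq0 pnatr_eq0 /= => /eqP ->; rewrite eqxx.
Qed.

(** If the Gram determinant vanishes, all tangent lines of the circle at the entries
    of z are orthogonal to the first entry of z, which therefore is not in the image
    of the differential. *)
Lemma regular_gram_gt0 (z : V) : (0 < m)%N -> torus m z ->
  regular_value m (sum_map z) -> 0 < gram z.
Proof.
move=> m0 tz rz; rewrite lt_neqAle gram_ge0 andbT eq_sym.
apply/negP => /eqP/gram_eq0 d0.
pose j0 := Ordinal m0; pose z0 := z ord0 j0.
have [v tv] := rz z tz erefl z0; rewrite tangent_mapE => sv.
have : Re z0 * Re z0 + Im z0 * Im z0 = 0.
  rewrite -{2 4}sv complex_Re_sum complex_Im_sum !mulr_sumr -big_split /= big1 // => j _.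
  have := tv j; have := d0 j0 j; rewrite /det2 -/z0.
  have := (normc_eq1 (z ord0 j)).1 (tz j).
  set x := Re (z ord0 j); set y := Im (z ord0 j).
  set u := Re (v ord0 j); set w := Im (v ord0 j) => n1 d t.
  transitivity ((Re z0 * x + Im z0 * y) * (x * u + y * w) +
                (Re z0 * y - x * Im z0) * (y * u - x * w)).
    by rewrite -[LHS]mulr1 -n1; ring.
  by rewrite d t mulr0 mul0r addr0.
have := (normc_eq1 z0).1 (tz j0); rewrite !expr2 => -> /eqP.
by rewrite oner_eq0.
Qed.

(** The Euclidean product of w with i z, which is the angular speed that w induces
    at the point z of the unit circle. *)
Definition ang (w z : C) : R := Im w * Re z - Re w * Im z.

(** The orthogonal projection of w to the tangent line of the unit circle at z. *)
Definition hvel (w z : C) : C := (- (ang w z * Im z)) +i* (ang w z * Re z).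

(** The vector w whose projections to the tangent lines at the entries of z add up
    to c: Cramer's rule for a 2 by 2 system of determinant [gram z]. *)
Definition control (z : V) (c : C) : C :=
  ((Re c * (\sum_j Re (z ord0 j) ^+ 2) +
    Im c * (\sum_j Re (z ord0 j) * Im (z ord0 j))) / gram z) +i*
  ((Re c * (\sum_j Re (z ord0 j) * Im (z ord0 j)) +
    Im c * (\sum_j Im (z ord0 j) ^+ 2)) / gram z).

(** A vector with zero sum is orthogonal to the constant vector w, and for a tangent
    vector only the tangential part of w matters. *)
Lemma horizontal_hvel (z : V) w (v : V) : torus m z ->
  (forall j, v ord0 j = hvel w (z ord0 j)) -> horizontal_space z v.
Proof.
move=> tz vE; split=> [j|u [tu]]; first by rewrite vE /=; ring.
rewrite tangent_mapE => su.
transitivity (\sum_j (Re w * Re (u ord0 j) + Im w * Im (u ord0 j))).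
  apply: eq_bigr => j _; rewrite vE /=; have := tu j.
  have := (normc_eq1 (z ord0 j)).1 (tz j); rewrite /ang.
  set x := Re (z ord0 j); set y := Im (z ord0 j).
  set a := Re (u ord0 j); set b := Im (u ord0 j) => n1 t.
  have H : y * a * (Re w * y - Im w * x) + x * b * (Im w * x - Re w * y) =
    (Re w * a + Im w * b) * (x ^+ 2 + y ^+ 2) - (Re w * x + Im w * y) * (x * a + y * b).
    by ring.
  rewrite t mulr0 subr0 n1 mulr1 in H; rewrite -H; ring.
rewrite big_split /= -!mulr_sumr -complex_Re_sum -complex_Im_sum su; ring.
Qed.

Lemma sum_hvel (z : V) w : \sum_j hvel w (z ord0 j) =
  (Re w * (\sum_j Im (z ord0 j) ^+ 2) - Im w * (\sum_j Re (z ord0 j) * Im (z ord0 j))) +i*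
  (Im w * (\sum_j Re (z ord0 j) ^+ 2) - Re w * (\sum_j Re (z ord0 j) * Im (z ord0 j))).
Proof.
apply: complexP; rewrite ?complex_Re_sum ?complex_Im_sum /= !mulr_sumr -sumrB;
  by apply: eq_bigr => j _; rewrite /ang; ring.
Qed.

Lemma sum_hvel_control (z : V) c : gram z != 0 ->
  \sum_j hvel (control z c) (z ord0 j) = c.
Proof.
by move=> g0; rewrite sum_hvel; apply: complexP => /=; move: g0; rewrite /gram => g0; field.
Qed.

Lemma inner_sub (u v w : V) : inner u (v - w) = inner u v - inner u w.
Proof.
rewrite /inner -sumrB; apply: eq_bigr => j _.
by rewrite !mxE complex_ReD complex_ImD complex_ReN complex_ImN; ring.
Qed.

Lemma inner_eq0 (u : V) : inner u u = 0 -> u = 0.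
Proof.
move=> u0; have H j : Re (u ord0 j) ^+ 2 + Im (u ord0 j) ^+ 2 = 0.
  move: u0 => /eqP; rewrite psumr_eq0 => [|i _].
    by move=> /allP /(_ j (mem_index_enum j)) /eqP /=; rewrite -!expr2.
  by rewrite -!expr2 addr_ge0 ?sqr_ge0.
apply/rowP => j; rewrite !mxE; have /eqP := H j.
rewrite paddr_eq0 ?sqr_ge0 // !sqrf_eq0 => /andP[/eqP a0 /eqP b0].
exact: complexP.
Qed.

(** The difference of v with the horizontal vector of the same sum is horizontal and
    lies in the kernel, so it is orthogonal to itself. *)
Lemma horizontal_spaceE (z v : V) : torus m z -> gram z != 0 ->
  horizontal_space z v ->
  forall j, v ord0 j = hvel (control z (\sum_k v ord0 k)) (z ord0 j).
Proof.
move=> tz g0 [tv kv].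
pose w : V := \row_j hvel (control z (\sum_k v ord0 k)) (z ord0 j).
have wE j : w ord0 j = hvel (control z (\sum_k v ord0 k)) (z ord0 j) by rewrite mxE.
have [tw kw] := horizontal_hvel tz wE.
have ku : tangent_kernel z (v - w).
  split=> [j|].
    rewrite !mxE complex_ReD complex_ImD complex_ReN complex_ImN -wE; have := tv j; have := tw j.
    by move=> e1 e2; rewrite !mulrDr !mulrN; lra.
  rewrite tangent_mapE; under eq_bigr => j _ do rewrite !mxE.
  by rewrite sumrB sum_hvel_control // subrr.
have /inner_eq0/eqP : inner (v - w) (v - w) = 0.
  by rewrite inner_sub kv // kw // subrr.
by rewrite subr_eq0 => /eqP vw j; rewrite {1}vw wE.
Qed.

End Horizontal.

(** * Coinciding coordinates along a horizontal curve *)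

Section PointwiseContinuity.
Context {R : realType} {T : topologicalType}.
Implicit Types (f g : T -> R) (x : T).

Lemma cont_cst (a : R) x : {for x, continuous (fun _ : T => a)}.
Proof. exact: cvg_cst. Qed.

Lemma cont_add f g x : {for x, continuous f} -> {for x, continuous g} ->
  {for x, continuous (fun t => f t + g t)}.
Proof. by move=> cf cg; exact: cvgD. Qed.

Lemma cont_mul f g x : {for x, continuous f} -> {for x, continuous g} ->
  {for x, continuous (fun t => f t * g t)}.
Proof. by move=> cf cg; exact: cvgM. Qed.

Lemma cont_opp f x : {for x, continuous f} -> {for x, continuous (fun t => - f t)}.
Proof. by move=> cf; exact: cvgN. Qed.

Lemma cont_inv f x : f x != 0 -> {for x, continuous f} ->
  {for x, continuous (fun t => (f t)^-1)}.
Proof. by move=> f0 cf; exact: cvgV. Qed.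

Lemma cont_sum n (f : 'I_n -> T -> R) x : (forall j, {for x, continuous (f j)}) ->
  {for x, continuous (fun t => \sum_j f j t)}.
Proof.
move=> cf; rewrite /prop_for.
elim: n f cf => [|n IH] f cf.
  rewrite (_ : (fun t => _) = fun=> 0); first exact: cvg_cst.
  by apply/funext => t; rewrite big_ord0.
rewrite (_ : (fun t => _) = fun t => f ord0 t + \sum_j f (lift ord0 j) t).
  apply: cont_add; first exact: cf.
  by apply: IH => j; exact: cf.
by apply/funext => t; rewrite big_ord_recl.
Qed.

Context {m : nat}.

Lemma cont_gram (z : T -> 'rV[R[i]]_m) x :
  (forall j, {for x, continuous (fun t => complex.Re (z t ord0 j))}) ->
  (forall j, {for x, continuous (fun t => complex.Im (z t ord0 j))}) ->
  {for x, continuous (fun t => gram (z t))}.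
Proof.
move=> cx cy; apply: cont_add.
  by apply: cont_mul; apply: cont_sum => j; apply: cont_mul.
by apply: cont_opp; apply: cont_mul; apply: cont_sum => j; apply: cont_mul.
Qed.

Lemma cont_control (z : T -> 'rV[R[i]]_m) (c : T -> R[i]) x : gram (z x) != 0 ->
  (forall j, {for x, continuous (fun t => complex.Re (z t ord0 j))}) ->
  (forall j, {for x, continuous (fun t => complex.Im (z t ord0 j))}) ->
  {for x, continuous (fun t => complex.Re (c t))} ->
  {for x, continuous (fun t => complex.Im (c t))} ->
  {for x, continuous (fun t => complex.Re (control (z t) (c t)))} /\
  {for x, continuous (fun t => complex.Im (control (z t) (c t)))}.
Proof.
move=> g0 cx cy cc1 cc2; have cg := cont_gram cx cy.
by split; apply: cont_mul; try (by apply: cont_inv); apply: cont_add;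
  apply: cont_mul => //; apply: cont_sum => j; apply: cont_mul.
Qed.

End PointwiseContinuity.

Section Segment.
Context {R : realType}.
Implicit Types f : R -> R.

Lemma within_segment_continuous f (a b : R) :
  (forall t, a <= t <= b -> {for t, continuous f}) -> {within `[a, b], continuous f}.
Proof.
move=> cf; apply: continuous_in_subspaceT => t; rewrite inE /= in_itv /=.
exact: cf.
Qed.

Lemma bounded_on_segment f (a b : R) : a <= b ->
  (forall t, a <= t <= b -> {for t, continuous f}) ->
  exists C, forall t, a <= t <= b -> `|f t| <= C.
Proof.
move=> ab cf.
have [c _ cP] := @EVT_max R (fun t => `|f t|) a b ab (within_segment_continuous
  (fun t tab => cvg_norm (cf t tab))).
by exists `|f c| => t tab; apply: cP; rewrite in_itv.
Qed.

(** The intermediate value theorem. *)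
Lemma nonvanishing_same_sign f (a b : R) : a <= b ->
  (forall t, a <= t <= b -> {for t, continuous f}) ->
  (forall t, a <= t <= b -> f t != 0) -> 0 < f a * f b.
Proof.
move=> ab cf f0.
have fa : f a != 0 by apply: f0; rewrite lexx.
have fb : f b != 0 by apply: f0; rewrite lexx andbT.
rewrite lt_neqAle eq_sym mulf_neq0 //= leNgt; apply/negP => fab.
have [|c] := @IVT R f a b 0 ab (within_segment_continuous cf).
  rewrite ge_min le_max; move: fa; rewrite neq_lt => /orP[fa0|fa0].
    apply/andP; split; apply/orP; [left|right]; apply: ltW => //.
    by move: fab; rewrite nmulr_rlt0.
  apply/andP; split; apply/orP; [right|left]; apply: ltW => //.
  by move: fab; rewrite pmulr_rlt0.
by rewrite in_itv => /f0 /eqP.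
Qed.

Lemma smooth_on_Ck (A : set R) (g : R -> R[i]) : smooth_on A g -> forall n,
  Ck n A (fun t => complex.Re (g t)) /\ Ck n A (fun t => complex.Im (g t)).
Proof.
by move=> sg n; split; apply: derive1n_Ck => k t At; case: (sg k t At).
Qed.

Lemma Ck_smooth_on (A : set R) (g : R -> R[i]) : (forall n,
  Ck n A (fun t => complex.Re (g t)) /\ Ck n A (fun t => complex.Im (g t))) ->
  smooth_on A g.
Proof. by move=> Cg n t At; have [C1 C2] := Cg n.+1; split; exact: Ck_derive1n At. Qed.

Lemma is_derive_velocity (A : set R) (g : R -> R[i]) t : smooth_on A g -> A t ->
  is_derive t 1 (fun s => complex.Re (g s)) (complex.Re (velocity g t)) /\
  is_derive t 1 (fun s => complex.Im (g s)) (complex.Im (velocity g t)).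
Proof.
move=> sg At; have [C1 C2] := smooth_on_Ck sg 1.
by split; [apply: Ck_is_derive C1 At | apply: Ck_is_derive C2 At].
Qed.

Lemma velocity_is (g : R -> R[i]) (t : R) (d : R[i]) :
  is_derive t 1 (fun s => complex.Re (g s)) (complex.Re d) ->
  is_derive t 1 (fun s => complex.Im (g s)) (complex.Im d) -> velocity g t = d.
Proof. by move=> d1 d2; apply: complexP => /=; apply: derive1_is. Qed.

Lemma continuous_velocity (A : set R) (g : R -> R[i]) t : smooth_on A g -> A t ->
  {for t, continuous (fun s => complex.Re (velocity g s))} /\
  {for t, continuous (fun s => complex.Im (velocity g s))}.
Proof.
move=> sg At; have [[_ C1] [_ C2]] := smooth_on_Ck sg 2.
by split; [exact: (is_derive_continuous (Ck_is_derive (n := 0) C1 At)) |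
           exact: (is_derive_continuous (Ck_is_derive (n := 0) C2 At))].
Qed.

Lemma subdivision_le k p (i j : nat) : @subdivision R k p -> (i <= j <= k)%N ->
  p i <= p j.
Proof.
move=> [_ _ pS] /andP[ij jk]; elim: j ij jk => [|j IH].
  by rewrite leqn0 => /eqP ->.
rewrite leq_eqVlt => /orP[/eqP -> //|]; rewrite ltnS => ij jk.
apply: le_trans (IH ij (ltnW jk)) (ltW (pS _ jk)).
Qed.

Lemma subdivision_itv k p (i : nat) : @subdivision R k p -> (i <= k)%N ->
  0 <= p i <= 1.
Proof.
move=> sp ik; have [p0 p1 _] := sp.
by rewrite -{1}p0 -p1 !(subdivision_le sp) ?ik ?leqnn.
Qed.

(** Induction along the pieces of a subdivided curve. *)
Lemma subdivision_ind k p (P : R -> Prop) : @subdivision R k p -> P 0 ->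
  (forall i, (i < k)%N -> P (p i) -> forall t, p i <= t <= p i.+1 -> P t) ->
  forall t, 0 <= t <= 1 -> P t.
Proof.
move=> sp P0 PS; have [p0 p1 _] := sp.
suff H i : (i <= k)%N -> forall t, 0 <= t <= p i -> P t.
  by move=> t; rewrite -p1; exact: H.
elim: i => [_|i IH ik] t /andP[t0 ti].
  suff -> : t = 0 by [].
  by apply/eqP; rewrite eq_le t0 -p0 ti.
have [tp|/ltW pt] := leP t (p i); first by apply: IH; rewrite ?t0 // ltnW.
apply: (PS i) => //; last by rewrite pt.
apply: IH; first exact: ltnW.
by rewrite lexx andbT; case/andP: (subdivision_itv sp (ltnW ik)).
Qed.

End Segment.

Section TwoValues.
Context {R : realType} {m : nat}.
Local Notation C := R[i].
Local Notation V := 'rV[R[i]]_m.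
Local Notation Re := complex.Re.
Local Notation Im := complex.Im.

(** The field hvel w is (w - conj(w) z^2) / 2, so the difference of its values at z
    and z' is z - z' times - conj(w) (z + z') / 2: the squared distance of two
    coordinates of a horizontal curve obeys a linear homogeneous equation. *)
Lemma hvel_dist_derive (w z z' : C) : `|z| = 1 -> `|z'| = 1 ->
  2 * ((Re z - Re z') * (Re (hvel w z) - Re (hvel w z')) +
       (Im z - Im z') * (Im (hvel w z) - Im (hvel w z'))) =
  - (Re w * (Re z + Re z') + Im w * (Im z + Im z')) *
  ((Re z - Re z') ^+ 2 + (Im z - Im z') ^+ 2).
Proof.
move=> /normc_eq1 n1 /normc_eq1 n2; rewrite /hvel /ang /=.
set x := Re z; set y := Im z; set x' := Re z'; set y' := Im z'.
set a := Re w; set b := Im w; rewrite -/x -/y -/x' -/y' in n1 n2.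
apply/eqP; rewrite -subr_eq0; apply/eqP.
transitivity ((a * (x' - x) + b * (y' - y)) *
  ((x' ^+ 2 + y' ^+ 2) - (x ^+ 2 + y ^+ 2))); first by ring.
by rewrite n1 n2 subrr mulr0.
Qed.

(** Regularity bounds the control w on the compact interval, hence the coefficient
    of the linear equation of [hvel_dist_derive], and the Gronwall estimate
    applies. *)
Lemma horizontal_piece_merge (a b : R) (gam : R -> V) (g : 'I_m -> R -> C) j k :
  a <= b ->
  (forall t, a <= t <= b -> torus m (gam t) /\ gram (gam t) != 0) ->
  (forall j, smooth_extension a b (fun s => gam s ord0 j) (g j)) ->
  (forall t, a <= t <= b -> horizontal_space (gam t) (\row_j velocity (g j) t)) ->
  gam a ord0 j = gam a ord0 k ->
  forall t, a <= t <= b -> gam t ord0 j = gam t ord0 k.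
Proof.
move=> ab tg sg hg jk.
have gE i t : a <= t <= b -> g i t = gam t ord0 i by move=> tab; have [_ ->] := sg i.
have dg i t : a <= t <= b ->
    is_derive t 1 (fun s => Re (g i s)) (Re (velocity (g i) t)) /\
    is_derive t 1 (fun s => Im (g i s)) (Im (velocity (g i) t)).
  move=> tab; have [[A [_ sA sm]] _] := sg i.
  by apply: is_derive_velocity sm _; apply: sA; rewrite /= in_itv.
pose G t : V := \row_i g i t.
have GE t : a <= t <= b -> G t = gam t by move=> tab; apply/rowP => i; rewrite !mxE gE.
pose w t := control (G t) (\sum_i velocity (g i) t).
have velE i t : a <= t <= b -> velocity (g i) t = hvel (w t) (g i t).
  move=> tab; have [tt rt] := tg t tab.
  have := horizontal_spaceE tt rt (hg t tab) i; rewrite !mxE => ->.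
  rewrite /w GE // gE //; congr hvel; congr control.
  by apply: eq_bigr => l _; rewrite mxE.
pose u t := (Re (g j t) - Re (g k t)) ^+ 2 + (Im (g j t) - Im (g k t)) ^+ 2.
pose kap t := - (Re (w t) * (Re (g j t) + Re (g k t)) +
                 Im (w t) * (Im (g j t) + Im (g k t))).
have ckap t : a <= t <= b -> {for t, continuous kap}.
  move=> tab; have cre i := is_derive_continuous (dg i t tab).1.
  have cim i := is_derive_continuous (dg i t tab).2.
  have cv i : {for t, continuous (fun s => Re (velocity (g i) s))} /\
              {for t, continuous (fun s => Im (velocity (g i) s))}.
    have [[A [_ sA sm]] _] := sg i.
    by apply: continuous_velocity sm _; apply: sA; rewrite /= in_itv.
  have [c1 c2] : {for t, continuous (fun s => Re (w s))} /\
                 {for t, continuous (fun s => Im (w s))}.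
    apply: cont_control => [|i|i||].
    - by rewrite GE //; case: (tg t tab).
    - by have -> : (fun s => Re (G s ord0 i)) = (fun s => Re (g i s))
        by apply/funext => s; rewrite mxE.
    - by have -> : (fun s => Im (G s ord0 i)) = (fun s => Im (g i s))
        by apply/funext => s; rewrite mxE.
    - have -> : (fun s => Re (\sum_i velocity (g i) s)) =
        (fun s => \sum_i Re (velocity (g i) s)) by apply/funext => s; exact: complex_Re_sum.
      by apply: cont_sum => i; exact: (cv i).1.
    - have -> : (fun s => Im (\sum_i velocity (g i) s)) =
        (fun s => \sum_i Im (velocity (g i) s)) by apply/funext => s; exact: complex_Im_sum.
      by apply: cont_sum => i; exact: (cv i).2.
  by apply: cont_opp; apply: cont_add; apply: cont_mul => //; apply: cont_add.
have [K KP] := bounded_on_segment ab ckap.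
have n1 i t : a <= t <= b -> `|g i t| = 1.
  by move=> tab; rewrite gE //; case: (tg t tab) => + _; exact.
have u0 t : a <= t <= b -> u t = 0.
  apply: (@gronwall0 R u (fun s => kap s * u s) a b K) => [s sab|s sab|s sab|].
  - rewrite /kap /u -hvel_dist_derive ?n1 // -!velE //.
    have [d1 d2] := dg j s sab; have [d3 d4] := dg k s sab.
    have D1 := is_deriveB1 d1 d3; have D2 := is_deriveB1 d2 d4.
    have := is_deriveD1 (is_deriveM1 D1 D1) (is_deriveM1 D2 D2).
    rewrite /u; congr is_derive.
    by ring.
  - by rewrite addr_ge0 ?sqr_ge0.
  - rewrite normrM [`|u s|]ger0_norm ?addr_ge0 ?sqr_ge0 //.
    by rewrite ler_wpM2r ?addr_ge0 ?sqr_ge0 // KP.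
  - by rewrite /u !gE ?lexx // jk !subrr expr0n addr0.
move=> t tab; have /eqP := u0 t tab; rewrite /u !gE //.
rewrite paddr_eq0 ?sqr_ge0 // !sqrf_eq0 !subr_eq0 => /andP[/eqP e1 /eqP e2].
exact: complexP.
Qed.

Lemma horizontal_merge (gam : R -> V) j k : horizontal_curve gam ->
  (forall t, 0 <= t <= 1 -> gram (gam t) != 0) ->
  gam 0 ord0 j = gam 0 ord0 k ->
  forall t, 0 <= t <= 1 -> gam t ord0 j = gam t ord0 k.
Proof.
move=> [tg [n [p [sp hp]]]] rg jk.
apply: (subdivision_ind sp) => // i ik e.
have [g [sg hg]] := hp i ik; have [_ _ pS] := sp.
apply: (horizontal_piece_merge (ltW (pS i ik)) _ sg hg e) => t /andP[it ti].
have t01 : 0 <= t <= 1.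
  have /andP[i0 _] := subdivision_itv sp (ltnW ik).
  have /andP[_ i1] := subdivision_itv sp ik.
  by rewrite (le_trans i0 it) (le_trans ti i1).
by split; [exact: tg|exact: rg].
Qed.

(** The determinant is continuous on each piece and does not vanish, so it keeps its
    sign from one subdivision point to the next. *)
Lemma horizontal_orientation (gam : R -> V) j k : horizontal_curve gam ->
  (forall t, 0 <= t <= 1 -> det2 (gam t ord0 j) (gam t ord0 k) != 0) ->
  0 < det2 (gam 0 ord0 j) (gam 0 ord0 k) * det2 (gam 1 ord0 j) (gam 1 ord0 k).
Proof.
move=> [tg [n [p [sp hp]]]] d0.
apply: (subdivision_ind (P := fun t =>
  0 < det2 (gam 0 ord0 j) (gam 0 ord0 k) * det2 (gam t ord0 j) (gam t ord0 k)) sp).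
- by rewrite -expr2 lt_neqAle sqr_ge0 andbT eq_sym sqrf_eq0 d0 ?lexx ?ler01.
- move=> i ik e t /andP[it ti]; have [g [sg _]] := hp i ik.
  have H s : p i <= s <= t -> 0 <= s <= 1 /\ p i <= s <= p i.+1.
    move=> /andP[is_ st]; have /andP[i0 _] := subdivision_itv sp (ltnW ik).
    have /andP[_ i1] := subdivision_itv sp ik.
    have si := le_trans st ti.
    by rewrite (le_trans i0 is_) (le_trans si i1) is_ si.
  have : 0 < det2 (g j (p i)) (g k (p i)) * det2 (g j t) (g k t).
    apply: (@nonvanishing_same_sign R (fun s => det2 (g j s) (g k s)) _ _ it) => s sit.
      have dg l : {for s, continuous (fun s => Re (g l s))} /\
                  {for s, continuous (fun s => Im (g l s))}.
        have [[A [_ sA sm]] _] := sg l; have [_ ss] := H s sit.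
        have As : A s by apply: sA; rewrite /= in_itv.
        by split; [exact: is_derive_continuous (is_derive_velocity sm As).1 |
                   exact: is_derive_continuous (is_derive_velocity sm As).2].
      have [a1 a2] := dg j; have [b1 b2] := dg k.
      by apply: cont_add; [exact: cont_mul|apply: cont_opp; exact: cont_mul].
    have [s01 ss] := H s sit; have [_ ->] := sg j => //; have [_ ->] := sg k => //.
    exact: d0.
  have pp : p i <= p i <= p i.+1 by case: (H (p i)) => //; rewrite lexx.
  have pt : p i <= t <= p i.+1 by rewrite it.
  have [_ gj] := sg j; have [_ gk] := sg k; rewrite !gj // !gk // => H1.
  have := mulr_gt0 e H1; set P := det2 _ _; set Q := det2 _ _; set S := det2 _ _.
  rewrite (_ : P * Q * (Q * S) = Q ^+ 2 * (P * S)); last by ring.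
  have Q0 : Q != 0 by apply/eqP => Q0; move: e; rewrite -/P -/Q Q0 mulr0 ltxx.
  by rewrite pmulr_rgt0 // lt_neqAle sqr_ge0 eq_sym sqrf_eq0 Q0.
- by rewrite ler01 lexx.
Qed.

(** The sum determines the angle between x and y up to sign, the orientation
    determines the sign, and then r x + s y is a fixed nonzero multiple of x. *)
Lemma two_vectors_unique (r s : R) (x y x' y' : C) : 0 < r -> 0 < s ->
  `|x| = 1 -> `|y| = 1 -> `|x'| = 1 -> `|y'| = 1 ->
  r%:C * x + s%:C * y = r%:C * x' + s%:C * y' ->
  0 < det2 x y * det2 x' y' -> x = x' /\ y = y'.
Proof.
move=> r0 s0 /normc_eq1 nx /normc_eq1 ny /normc_eq1 nx' /normc_eq1 ny' e.
have e1 := congr1 (@complex.Re R) e; have e2 := congr1 (@complex.Im R) e.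
move: e1 e2; rewrite !complex_ReD !complex_ImD. rewrite !complex_ReM !complex_ImM /= !mul0r !subr0 !addr0 /det2 => {e}.
move: nx ny nx' ny'.
case: x => x1 x2; case: y => y1 y2; case: x' => a1 a2; case: y' => b1 b2 /=.
move=> nx ny nx' ny' e1 e2 dd.
have dot : x1 * y1 + x2 * y2 = a1 * b1 + a2 * b2.
  have rs : 2 * r * s != 0 by rewrite !mulf_neq0 ?gt_eqF.
  apply: (mulfI rs).
  have polar (u1 u2 v1 v2 : R) : 2 * r * s * (u1 * v1 + u2 * v2) =
    (r * u1 + s * v1) ^+ 2 + (r * u2 + s * v2) ^+ 2 -
    r ^+ 2 * (u1 ^+ 2 + u2 ^+ 2) - s ^+ 2 * (v1 ^+ 2 + v2 ^+ 2) by ring.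
  by rewrite !polar e1 e2 nx ny nx' ny'.
have det : x1 * y2 - y1 * x2 = a1 * b2 - b1 * a2.
  have : (x1 * y2 - y1 * x2) ^+ 2 = (a1 * b2 - b1 * a2) ^+ 2.
    have lagrange (u1 u2 v1 v2 : R) : (u1 * v2 - v1 * u2) ^+ 2 =
      (u1 ^+ 2 + u2 ^+ 2) * (v1 ^+ 2 + v2 ^+ 2) - (u1 * v1 + u2 * v2) ^+ 2 by ring.
    by rewrite !lagrange dot nx ny nx' ny'.
  move/eqP; rewrite eqf_sqr => /orP[/eqP //|/eqP dN].
  by move: dd; rewrite dN mulNr oppr_gt0 -expr2 ltNge sqr_ge0.
(* y is obtained from x by the rotation with cosine d and sine e *)
pose d := x1 * y1 + x2 * y2; pose e := x1 * y2 - y1 * x2.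
have e0 : e != 0 by apply/eqP => e0; move: dd; rewrite -/e e0 mul0r ltxx.
have AB : (r + s * d) ^+ 2 + (s * e) ^+ 2 != 0.
  by rewrite paddr_eq0 ?sqr_ge0 // !sqrf_eq0 !mulf_eq0 (gt_eqF s0) (negbTE e0) andbF.
have rot (u1 u2 v1 v2 : R) : u1 ^+ 2 + u2 ^+ 2 = 1 -> u1 * v1 + u2 * v2 = d ->
    u1 * v2 - v1 * u2 = e -> v1 = d * u1 - e * u2 /\ v2 = d * u2 + e * u1.
  move=> n <- <-; split.
    by rewrite -[LHS]mulr1 -n; ring.
  by rewrite -[LHS]mulr1 -n; ring.
have [y1E y2E] := rot x1 x2 y1 y2 nx erefl erefl.
have [b1E b2E] := rot a1 a2 b1 b2 nx' (esym dot) (esym det).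
have sol u1 u2 : ((r + s * d) ^+ 2 + (s * e) ^+ 2) * u1 =
    (r + s * d) * (r * u1 + s * (d * u1 - e * u2)) +
    s * e * (r * u2 + s * (d * u2 + e * u1)) by ring.
have sol2 u1 u2 : ((r + s * d) ^+ 2 + (s * e) ^+ 2) * u2 =
    (r + s * d) * (r * u2 + s * (d * u2 + e * u1)) -
    s * e * (r * u1 + s * (d * u1 - e * u2)) by ring.
have xa1 : x1 = a1.
  by apply: (mulfI AB); rewrite (sol x1 x2) (sol a1 a2) -y1E -y2E -b1E -b2E e1 e2.
have xa2 : x2 = a2.
  by apply: (mulfI AB); rewrite (sol2 x1 x2) (sol2 a1 a2) -y1E -y2E -b1E -b2E e1 e2.
by split; [rewrite xa1 xa2|rewrite y1E y2E b1E b2E xa1 xa2].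
Qed.

End TwoValues.

(** * Configurations with two values are fixed *)

Section TwoValuesFixed.
Context {R : realType} {m : nat}.
Local Notation C := R[i].
Local Notation V := 'rV[R[i]]_m.

Lemma card_range2P (F : 'I_m -> C) : (range F #= `I_2)%card <->
  exists j k, F j != F k /\ forall l, F l = F j \/ F l = F k.
Proof.
split.
  move=> /eq_cardSP [_ [j _ <-] /eq_cardSP [_ [[k _ <-] kj]]].
  rewrite II0 card_eq0 => /eqP E; exists j, k.
  split; first by rewrite eq_sym; apply/eqP.
  move=> l; have [|lj] := pselect (F l = F j); first by left.
  right; apply: contrapT => lk.
  suff : set0 (F l) by [].
  by rewrite -E; split=> //; split=> //; exists l.
move=> [j [k [jk H]]]; apply/eq_cardSP; exists (F j); first by exists j.
apply/eq_cardSP; exists (F k).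
  by split; [exists k|apply/eqP; rewrite eq_sym].
rewrite II0 card_eq0; apply/eqP; rewrite -subset0 => _ [[[l _ <-] lj] lk].
by have [/lj|/lk] := H l.
Qed.

(** The lift keeps its two blocks of equal coordinates, with values x and y, say.
    The loop r x + s y and the orientation of (x, y), which cannot change over
    regular values, determine x and y at the end of the loop. *)
Lemma two_values_fixed (b : C) (U : set C) (z : fiber m b) : (0 < m)%N ->
  U `<=` regular_value m ->
  (range (fun j : 'I_m => (\val z : V) ord0 j) #= `I_2)%card ->
  fixed_points m b U z.
Proof.
move=> m0 Ureg /card_range2P [j [k [jk zjk]]] phi [c [_ c0 c1 cU] hphi].
have [gam [[hc sc] g0 g1]] := hphi z.
have tg t : 0 <= t <= 1 -> torus m (gam t) by case: hc => + _; exact.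
have rg t : 0 <= t <= 1 -> gram (gam t) != 0.
  move=> t01; rewrite gt_eqF // regular_gram_gt0 //; first exact: tg.
  by rewrite sc //; apply/Ureg/cU.
have mj t l : 0 <= t <= 1 -> gam 0 ord0 l = gam 0 ord0 j -> gam t ord0 l = gam t ord0 j.
  by move=> t01 e; exact: (horizontal_merge hc rg e).
have mk t l : 0 <= t <= 1 -> gam 0 ord0 l = gam 0 ord0 k -> gam t ord0 l = gam t ord0 k.
  by move=> t01 e; exact: (horizontal_merge hc rg e).
rewrite -g0 in jk zjk.
have det_jk t : 0 <= t <= 1 -> det2 (gam t ord0 j) (gam t ord0 k) != 0.
  move=> t01; apply/eqP => d0; have [l [l' /eqP]] := gram_neq0 (rg t t01); apply.
  have [/(mj t _ t01) ->|/(mk t _ t01) ->] := zjk l;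
    have [/(mj t _ t01) ->|/(mk t _ t01) ->] := zjk l' => //;
    move: d0; rewrite /det2; lra.
have sgn := horizontal_orientation hc det_jk.
pose P := [pred l : 'I_m | gam 0 ord0 l == gam 0 ord0 j].
have sumE t : 0 <= t <= 1 -> sum_map (gam t) =
    (#|P|%:R : R)%:C * gam t ord0 j + (#|[predC P]|%:R : R)%:C * gam t ord0 k.
  move=> t01; rewrite /sum_map (bigID P) /= !rmorph_nat !mulr_natl -!sumr_const.
  congr (_ + _); apply: eq_bigr => l.
    by move=> /eqP; exact: mj.
  by move=> /eqP lj; apply: mk => //; have [] := zjk l.
have i0 : 0 <= (0 : R) <= 1 by rewrite lexx ler01.
have i1 : 0 <= (1 : R) <= 1 by rewrite lexx ler01.
have [ej ek] : gam 0 ord0 j = gam 1 ord0 j /\ gam 0 ord0 k = gam 1 ord0 k.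
  apply: (@two_vectors_unique _ #|P|%:R #|[predC P]|%:R) => //.
  - by rewrite ltr0n; apply/card_gt0P; exists j; rewrite inE.
  - by rewrite ltr0n; apply/card_gt0P; exists k; rewrite !inE eq_sym.
  - exact: tg.
  - exact: tg.
  - exact: tg.
  - exact: tg.
  - by rewrite -!sumE // !sc // c0 c1.
apply: val_inj; rewrite -[LHS]g1 -[RHS]g0; apply/rowP => l.
by have [e|e] := zjk l; [rewrite (mj 1) // -ej e|rewrite (mk 1) // -ek e].
Qed.

End TwoValuesFixed.

(** * Fields on the torus in angular coordinates *)

Section TameFields.
Context {R : realType} {m : nat}.
Implicit Types h k : R -> ('I_m -> R) -> R.

(** What the existence theorem asks of a field.  All operations that build the
    horizontal field in angular coordinates preserve this property. *)
Definition tame h : Prop :=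
  [/\ exists B, forall t x, `|h t x| <= B,
      exists L, 0 <= L /\ forall t (x y : 'I_m -> R) d,
        (forall i, `|x i - y i| <= d) -> `|h t x - h t y| <= L * d &
      forall th : 'I_m -> R -> R, (forall j, continuous (th j)) ->
        continuous (fun t => h t (fun i => th i t))].

Lemma tame_time (f : R -> R) B : (forall t, `|f t| <= B) -> continuous f ->
  tame (fun t _ => f t).
Proof.
move=> fB cf; split=> [||//]; first by exists B.
by exists 0; split=> // t x y d _; rewrite subrr normr0 mul0r.
Qed.

Lemma tameN h : tame h -> tame (fun t x => - h t x).
Proof.
move=> [[B hB] [L [L0 hL]] hc]; split.
- by exists B => t x; rewrite normrN.
- by exists L; split=> // t x y d /hL; rewrite -opprD normrN; exact.
- by move=> th cth t; apply: cont_opp; exact: hc.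
Qed.

Lemma tameD h k : tame h -> tame k -> tame (fun t x => h t x + k t x).
Proof.
move=> [[B hB] [L [L0 hL]] hc] [[B' kB] [L' [L'0 kL]] kc]; split.
- exists (B + B') => t x; apply: le_trans (ler_normD _ _) _; exact: lerD.
- exists (L + L'); split=> [|t x y d xy]; first exact: addr_ge0.
  rewrite opprD addrACA mulrDl; apply: le_trans (ler_normD _ _) _.
  by apply: lerD; [exact: hL|exact: kL].
- by move=> th cth t; apply: cont_add; [exact: hc|exact: kc].
Qed.

Lemma tameM h k : tame h -> tame k -> tame (fun t x => h t x * k t x).
Proof.
move=> [[B hB] [L [L0 hL]] hc] [[B' kB] [L' [L'0 kL]] kc].
have B0 : 0 <= B := le_trans (normr_ge0 _) (hB 0 (fun=> 0)).
have B'0 : 0 <= B' := le_trans (normr_ge0 _) (kB 0 (fun=> 0)).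
split.
- by exists (B * B') => t x; rewrite normrM ler_pM.
- exists (L * B' + B * L'); split=> [|t x y d xy].
    by rewrite addr_ge0 // mulr_ge0.
  have -> : h t x * k t x - h t y * k t y =
    (h t x - h t y) * k t x + h t y * (k t x - k t y) by ring.
  apply: le_trans (ler_normD _ _) _; rewrite !normrM mulrDl.
  rewrite [L * B' * d]mulrAC -[B * L' * d]mulrA; apply: lerD; apply: ler_pM => //.
    exact: hL.
  exact: kL.
- by move=> th cth t; apply: cont_mul; [exact: hc|exact: kc].
Qed.

Lemma tame_sum n (h : 'I_n -> R -> ('I_m -> R) -> R) : (forall j, tame (h j)) ->
  tame (fun t x => \sum_j h j t x).
Proof.
elim: n h => [|n IH] h th.
  rewrite (_ : (fun t x => _) = fun _ _ => 0).
    apply: (@tame_time (fun=> 0) 0) => [t|]; first by rewrite normr0.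
    exact: cst_continuous.
  by apply/funext => t; apply/funext => x; rewrite big_ord0.
rewrite (_ : (fun t x => _) = fun t x => h ord0 t x + \sum_j h (lift ord0 j) t x).
  by apply: tameD => //; exact: IH.
by apply/funext => t; apply/funext => x; rewrite big_ord_recl.
Qed.

Lemma tame_trig (f f' : R -> R) j : (forall t : R, is_derive t 1 f (f' t)) ->
  (forall t, `|f t| <= 1) -> (forall t, `|f' t| <= 1) ->
  tame (fun _ x => f (x j)).
Proof.
move=> df f1 f'1; split.
- by exists 1 => _ x.
- exists 1; split=> // _ x y d xy; rewrite mul1r.
  apply: le_trans (is_derive_lipschitz df f'1 _ _) _.
  by rewrite mul1r.
- move=> th cth t; apply: (@continuous_comp _ _ _ (th j) f); first exact: cth.
  exact: is_derive_continuous (df _).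
Qed.

Lemma tame_cos j : tame (fun _ x => cos (x j)).
Proof.
apply: tame_trig (fun t => is_derive_cos t) (@cos_max R) _ => t.
by rewrite normrN sin_max.
Qed.

Lemma tame_sin j : tame (fun _ x => sin (x j)).
Proof. exact: tame_trig (fun t => is_derive_sin t) (@sin_max R) (@cos_max R). Qed.

(** Dividing by max(h, e) instead of h keeps the field globally Lipschitz even where
    h vanishes. *)
Lemma tame_inv_max h (e : R) : 0 < e -> tame h ->
  tame (fun t x => (Num.max (h t x) e)^-1).
Proof.
move=> e0 [_ [L [L0 hL]] hc].
have M0 r : 0 < Num.max r e by rewrite lt_max e0 orbT.
have Me r : e <= Num.max r e by rewrite le_max lexx orbT.
split.
- exists e^-1 => t x; rewrite ger0_norm; last by rewrite invr_ge0 ltW.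
  by rewrite lef_pV2 ?posrE.
- exists (L * (e^-1 * e^-1)); split=> [|t x y d xy].
    by rewrite !mulr_ge0 // invr_ge0 ltW.
  have -> : (Num.max (h t x) e)^-1 - (Num.max (h t y) e)^-1 =
      (Num.max (h t y) e - Num.max (h t x) e) *
      ((Num.max (h t x) e)^-1 * (Num.max (h t y) e)^-1).
    by field; rewrite !gt_eqF.
  rewrite normrM mulrAC; apply: ler_pM => //; last first.
    have V0 r : 0 <= (Num.max r e)^-1 by rewrite invr_ge0 ltW.
    have Ve r : (Num.max r e)^-1 <= e^-1 by rewrite lef_pV2 ?posrE.
    by rewrite ger0_norm ?mulr_ge0 //; apply: ler_pM.
  apply: le_trans (hL t x y d xy); rewrite distrC.
  have := ler_norm (h t x - h t y); have := ler_norm (- (h t x - h t y)).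
  have := normr_ge0 (h t x - h t y); rewrite normrN ler_norml.
  by rewrite /Num.max; case: ltP => a; case: ltP => b n0 n1 n2; apply/andP; split; lra.
- move=> th cth t.
  apply: (@cont_inv R _ (fun t => Num.max (h t (fun i => th i t)) e)).
    by rewrite gt_eqF.
  by apply: continuous_max; [exact: hc|exact: cst_continuous].
Qed.

Lemma tame_picard (F : 'I_m -> R -> ('I_m -> R) -> R) (x0 : 'I_m -> R) :
  (0 < m)%N -> (forall j, tame (F j)) ->
  exists th : 'I_m -> R -> R, (forall j, th j 0 = x0 j) /\
    forall j (t : R), is_derive t 1 (th j) (F j t (fun i => th i t)).
Proof.
move=> m_gt0 tF.
have /choice [B FB] : forall j, exists B, forall t x, `|F j t x| <= B.
  by move=> j; case: (tF j).
have /choice [L FL] : forall j, exists L, 0 <= L /\ forall t (x y : 'I_m -> R) d,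
    (forall i, `|x i - y i| <= d) -> `|F j t x - F j t y| <= L * d.
  by move=> j; case: (tF j).
have B0 j : 0 <= B j := le_trans (normr_ge0 _) (FB j 0 (fun=> 0)).
have le_sum (f : 'I_m -> R) j : (forall i, 0 <= f i) -> f j <= \sum_i f i.
  by move=> f0; rewrite (bigD1 j) //= lerDl sumr_ge0.
apply: (@picard R m F (\sum_i B i) (\sum_i L i + 1)).
- by rewrite ltr_wpDl // sumr_ge0 // => i _; case: (FL i).
- by move=> th cth j; case: (tF j) => _ _; exact.
- by move=> j t x; apply: le_trans (FB j t x) _; exact: le_sum.
- move=> j t x y d xy; have [Lj0 FLj] := FL j.
  apply: le_trans (FLj t x y d xy) _; apply: ler_wpM2r.
    exact: le_trans (normr_ge0 _) (xy (Ordinal m_gt0)).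
  apply: le_trans (le_sum L j _) _; last by rewrite lerDl.
  by move=> i; case: (FL i).
Qed.

End TameFields.

Section Angles.
Context {R : realType} {m : nat}.
Local Notation C := R[i].
Local Notation V := 'rV[R[i]]_m.
Local Notation Re := complex.Re.
Local Notation Im := complex.Im.

Definition angles (x : 'I_m -> R) : V := \row_j (cos (x j) +i* sin (x j)).

Lemma torus_angles x : torus m (angles x).
Proof. by move=> j; rewrite mxE; apply/normc_eq1; rewrite /= cos2Dsin2. Qed.

Lemma unit_angle (u : C) : `|u| = 1 ->
  exists a : R, - pi <= a <= pi /\ cos a +i* sin a = u.
Proof.
move=> /normc_eq1; case: u => x y /= n.
have x1 : -1 <= x <= 1.
  by have yy := sqr_ge0 y; apply/andP; split; nra.
have c : cos (acos x) = x by rewrite acosK // in_itv.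
have y2 : 1 - x ^+ 2 = y ^+ 2 by rewrite -n; ring.
have a0 := acos_ge0 x1; have ap := acos_lepi x1; have := sin_acos x1; rewrite y2 sqrtr_sqr.
have [y0|y0] := leP 0 y.
  move=> s; exists (acos x); split; last by rewrite c s ger0_norm.
  by rewrite ap andbT (le_trans _ a0) // oppr_le0 pi_ge0.
move=> s; exists (- acos x); split; last by rewrite cosN sinN c s ltr0_norm ?opprK.
by rewrite lerN2 ap /= (le_trans _ (pi_ge0 R)) // oppr_le0.
Qed.

Lemma torus_angles_surj (z : V) : torus m z ->
  exists x : 'I_m -> R, (forall j, - pi <= x j <= pi) /\ angles x = z.
Proof.
move=> tz.
have /choice [x xP] : forall j, exists a : R, - pi <= a <= pi /\
    cos a +i* sin a = z ord0 j by move=> j; exact/unit_angle/tz.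
exists x; split=> [j|]; first by case: (xP j).
by apply/rowP => j; rewrite !mxE; case: (xP j).
Qed.

Definition sqdist (u v : C) : R := (Re u - Re v) ^+ 2 + (Im u - Im v) ^+ 2.

Lemma sqdist_ge0 u v : 0 <= sqdist u v.
Proof. by rewrite addr_ge0 ?sqr_ge0. Qed.

Lemma sqdist_eq0 u v : sqdist u v = 0 -> u = v.
Proof.
move/eqP; rewrite paddr_eq0 ?sqr_ge0 // !sqrf_eq0 !subr_eq0.
by move=> /andP[/eqP e1 /eqP e2]; exact: complexP.
Qed.

Lemma cont_sqdist (T : topologicalType) (u v : T -> C) p :
  {for p, continuous (fun t => Re (u t))} -> {for p, continuous (fun t => Im (u t))} ->
  {for p, continuous (fun t => Re (v t))} -> {for p, continuous (fun t => Im (v t))} ->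
  {for p, continuous (fun t => sqdist (u t) (v t))}.
Proof.
move=> u1 u2 v1 v2; have d1 := cont_add u1 (cont_opp v1).
have d2 := cont_add u2 (cont_opp v2).
exact: cont_add (cont_mul d1 d1) (cont_mul d2 d2).
Qed.

(** The sum of the two terms is positive on the torus times [0, 1]: where the second
    one vanishes, z lies over a regular value and the first one is positive.
    Compactness is used in the cube of angles. *)
Lemma gram_uniform (c : R -> C) : (0 < m)%N ->
  continuous (fun t => Re (c t)) -> continuous (fun t => Im (c t)) ->
  (forall t, 0 <= t <= 1 -> regular_value m (c t)) ->
  exists2 e, 0 < e & forall t z, 0 <= t <= 1 -> torus m z ->
    e <= gram z + sqdist (sum_map z) (c t).
Proof.
move=> m0 c1 c2 reg.
pose Phi (p : 'rV[R]_m * R) : R := gram (angles (p.1 ord0)) +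
  sqdist (sum_map (angles (p.1 ord0))) (c p.2).
pose K : set ('rV[R]_m * R) :=
  [set v : 'rV[R]_m | forall i : 'I_m, `[- pi, pi]%classic (v ord0 i)] `*` `[0, 1].
have cco j : continuous (fun p : 'rV[R]_m * R => p.1 ord0 j).
  move=> p; apply: (@continuous_comp _ _ _ fst (fun v : 'rV[R]_m => v ord0 j)).
    exact: cvg_fst.
  exact: coord_continuous.
have ccos j : continuous (fun p : 'rV[R]_m * R => cos (p.1 ord0 j)).
  move=> p; apply: (@continuous_comp _ R R (fun p : 'rV[R]_m * R => p.1 ord0 j) (@cos R)); first exact: cco.
  exact: continuous_cos.
have csin j : continuous (fun p : 'rV[R]_m * R => sin (p.1 ord0 j)).
  move=> p; apply: (@continuous_comp _ R R (fun p : 'rV[R]_m * R => p.1 ord0 j) (@sin R)); first exact: cco.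
  exact: continuous_sin.
have cRe : continuous (fun p : 'rV[R]_m * R => Re (c p.2)).
  move=> p; apply: (@continuous_comp _ _ _ snd (fun t => Re (c t))); first exact: cvg_snd.
  exact: c1.
have cIm : continuous (fun p : 'rV[R]_m * R => Im (c p.2)).
  move=> p; apply: (@continuous_comp _ _ _ snd (fun t => Im (c t))); first exact: cvg_snd.
  exact: c2.
have aRe j : (fun p : 'rV[R]_m * R => Re (angles (p.1 ord0) ord0 j)) =
    (fun p => cos (p.1 ord0 j)) by apply/funext => p; rewrite mxE.
have aIm j : (fun p : 'rV[R]_m * R => Im (angles (p.1 ord0) ord0 j)) =
    (fun p => sin (p.1 ord0 j)) by apply/funext => p; rewrite mxE.
have sRe : (fun p : 'rV[R]_m * R => Re (sum_map (angles (p.1 ord0)))) =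
    (fun p => \sum_j cos (p.1 ord0 j)).
  by apply/funext => p; rewrite complex_Re_sum; apply: eq_bigr => j _; rewrite mxE.
have sIm : (fun p : 'rV[R]_m * R => Im (sum_map (angles (p.1 ord0)))) =
    (fun p => \sum_j sin (p.1 ord0 j)).
  by apply/funext => p; rewrite complex_Im_sum; apply: eq_bigr => j _; rewrite mxE.
have cPhi : continuous Phi.
  move=> p; apply: (@cont_add R ('rV[R]_m * R)%type (fun p => gram (angles (p.1 ord0)))
    (fun p => sqdist (sum_map (angles (p.1 ord0))) (c p.2)) p).
    apply: cont_gram => j; first by rewrite aRe; exact: ccos.
    by rewrite aIm; exact: csin.
  apply: cont_sqdist; first by rewrite sRe; apply: cont_sum => j; exact: ccos.
  - by rewrite sIm; apply: cont_sum => j; exact: csin.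
  - exact: cRe.
  - exact: cIm.
have Kc : compact K.
  apply: compact_setX; last exact: segment_compact.
  by apply: (@rV_compact R m (fun=> `[- pi, pi]%classic)) => i; exact: segment_compact.
have K0 : K !=set0.
  exists (0, 0); split=> [i|]; rewrite /= in_itv /= ?lexx ?ler01 //.
  by rewrite mxE oppr_le0 pi_ge0.
have [[v s] /set_mem [vK sK] vmin] := compact_EVT_min K0 Kc (continuous_subspaceT cPhi).
exists (Phi (v, s)).
  have s01 : 0 <= s <= 1 by move: sK; rewrite /= in_itv.
  rewrite lt_neqAle eq_sym addr_ge0 ?gram_ge0 ?sqdist_ge0 // andbT.
  apply/negP; rewrite paddr_eq0 ?gram_ge0 ?sqdist_ge0 // => /andP[g0 /eqP /sqdist_eq0 e].
  have : 0 < gram (angles (v ord0)).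
    apply: regular_gram_gt0 => //; first exact: torus_angles.
    by rewrite e /=; exact: reg.
  by rewrite (eqP g0) ltxx.
move=> t z t01 tz; have [x [xK <-]] := torus_angles_surj tz.
have := vmin (\row_j x j, t); rewrite {2}/Phi /=.
have -> : angles ((\row_j x j) ord0) = angles x.
  by apply/rowP => j; rewrite !mxE.
apply; apply/mem_set; split=> [i|]; last by rewrite /= in_itv.
by rewrite /= mxE in_itv /= xK.
Qed.

End Angles.

(** * Existence of horizontal lifts *)

Section LiftExistence.
Context {R : realType} {m : nat}.
Local Notation C := R[i].
Local Notation V := 'rV[R[i]]_m.
Local Notation Re := complex.Re.
Local Notation Im := complex.Im.

(** A smooth horizontal lift over [0, 1]; gam itself plays the role of the smooth
    extension. *)
Definition lift_piece (c : R -> C) (gam : R -> V) : Prop :=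
  (forall t, 0 <= t <= 1 ->
    [/\ torus m (gam t), sum_map (gam t) = c t &
        horizontal_space (gam t) (\row_j velocity (fun s => gam s ord0 j) t)]) /\
  exists A : set R, [/\ open A, `[0, 1] `<=` A &
    forall j, smooth_on A (fun s => gam s ord0 j)].

Lemma gram_angles (x : 'I_m -> R) : gram (angles x) =
  (\sum_j cos (x j) ^+ 2) * (\sum_j sin (x j) ^+ 2) -
  (\sum_j cos (x j) * sin (x j)) ^+ 2.
Proof.
by rewrite /gram; congr (_ * _ - _ ^+ 2); apply: eq_bigr => j _; rewrite mxE.
Qed.

(** The horizontal field divides by the Gram determinant, which vanishes at the
    critical points.  The field with max(gram, e) in its place is globally
    Lipschitz, and its solution follows c up to an error whose square E
    satisfies |E'| <= K E, because gram + E >= 2 e by [gram_uniform]; hence E = 0.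
    The solution then stays where gram > e, the equation is the exact one there, and
    its regularity follows by induction on the order. *)
Lemma lift_exists (c : R -> C) (q : V) : (0 < m)%N -> smooth_on setT c ->
  (forall t, 0 <= t <= 1 -> regular_value m (c t)) ->
  torus m q -> sum_map q = c 0 ->
  exists2 gam, lift_piece c gam & gam 0 = q.
Proof.
move=> m0 sc reg tq qc.
have dc t := is_derive_velocity sc (I : setT t).
have cRe : continuous (fun t => Re (c t)) by move=> t; exact: is_derive_continuous (dc t).1.
have cIm : continuous (fun t => Im (c t)) by move=> t; exact: is_derive_continuous (dc t).2.
have [e0 e0_gt0 e0P] := gram_uniform m0 cRe cIm reg.
pose e := e0 / 2; have e_gt0 : 0 < e by rewrite divr_gt0.
have [x0 [_ x0q]] := torus_angles_surj tq.
(* outside [-1, 2] the velocity of c is frozen, which makes it bounded *)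
pose clamp (t : R) : R := Num.max (-1) (Num.min t 2).
have clamp_itv t : -1 <= clamp t <= 2.
  rewrite /clamp /Num.max /Num.min.
  by case: (ltP t 2) => a; case: ltP => b; apply/andP; split; lra.
have clampE t : -1 <= t <= 2 -> clamp t = t.
  move=> /andP[t1 t2]; rewrite /clamp /Num.max /Num.min.
  by case: (ltP t 2) => a; case: ltP => b; lra.
have cclamp : continuous clamp.
  move=> t.
  have cm : {for t, continuous (fun s : R => Num.min s 2)}.
    by apply: continuous_min; [exact: cvg_id|exact: cst_continuous].
  have c1 : {for t, continuous (fun _ : R => -1 : R)} by exact: cst_continuous.
  exact: (continuous_max c1 cm).
pose V1 t := Re (velocity c (clamp t)); pose V2 t := Im (velocity c (clamp t)).
have cV t := continuous_velocity sc (I : setT t).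
have cV1 : continuous V1.
  move=> t; apply: (@continuous_comp _ R R clamp (fun s => Re (velocity c s))).
    exact: cclamp.
  exact: (cV _).1.
have cV2 : continuous V2.
  move=> t; apply: (@continuous_comp _ R R clamp (fun s => Im (velocity c s))).
    exact: cclamp.
  exact: (cV _).2.
have N12 : (-1 : R) <= 2 by lra.
have [K1 K1P] := bounded_on_segment N12 (fun t _ => (cV t).1).
have [K2 K2P] := bounded_on_segment N12 (fun t _ => (cV t).2).
pose Sxx (x : 'I_m -> R) := \sum_j cos (x j) * cos (x j).
pose Sxy (x : 'I_m -> R) := \sum_j cos (x j) * sin (x j).
pose Syy (x : 'I_m -> R) := \sum_j sin (x j) * sin (x j).
pose G x := Sxx x * Syy x - Sxy x * Sxy x.
have GE x : G x = gram (angles x) by rewrite gram_angles.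
pose D x := (Num.max (G x) e)^-1.
pose wa t x := (V1 t * Sxx x + V2 t * Sxy x) * D x.
pose wb t x := (V1 t * Sxy x + V2 t * Syy x) * D x.
pose F (j : 'I_m) t x := wb t x * cos (x j) - wa t x * sin (x j).
have tF j : tame (F j).
  have tV1 : tame (fun t (_ : 'I_m -> R) => V1 t) by apply: (tame_time (B := K1)) => // t; exact: K1P.
  have tV2 : tame (fun t (_ : 'I_m -> R) => V2 t) by apply: (tame_time (B := K2)) => // t; exact: K2P.
  have tc i := @tame_cos R m i; have ts i := @tame_sin R m i.
  have txx : tame (fun _ x => Sxx x) by apply: tame_sum => i; exact: tameM.
  have txy : tame (fun _ x => Sxy x) by apply: tame_sum => i; exact: tameM.
  have tyy : tame (fun _ x => Syy x) by apply: tame_sum => i; exact: tameM.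
  have tG : tame (fun _ x => G x) by apply: tameD; [exact: tameM|apply: tameN; exact: tameM].
  have tD : tame (fun _ x => D x) by exact: tame_inv_max.
  have twa : tame wa by apply: tameM tD; apply: tameD; exact: tameM.
  have twb : tame wb by apply: tameM tD; apply: tameD; exact: tameM.
  by apply: tameD; [exact: tameM|apply: tameN; exact: tameM].
have [th [th0 dth]] := tame_picard x0 m0 tF.
pose X t : 'I_m -> R := fun j => th j t.
have dcos j (t : R) : is_derive t 1 (fun s => cos (th j s)) (- sin (th j t) * F j t (X t)).
  exact: (@is_derive1_comp _ (@cos R) (th j) _ _ _ (is_derive_cos _) (dth j t)).
have dsin j (t : R) : is_derive t 1 (fun s => sin (th j s)) (cos (th j t) * F j t (X t)).
  exact: (@is_derive1_comp _ (@sin R) (th j) _ _ _ (is_derive_sin _) (dth j t)).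
have ReX t : Re (sum_map (angles (X t))) = \sum_j cos (th j t).
  by rewrite complex_Re_sum; apply: eq_bigr => j _; rewrite mxE.
have ImX t : Im (sum_map (angles (X t))) = \sum_j sin (th j t).
  by rewrite complex_Im_sum; apply: eq_bigr => j _; rewrite mxE.
have sum1 t : \sum_j - sin (th j t) * F j t (X t) = V1 t * (G (X t) * D (X t)).
  transitivity (wa t (X t) * Syy (X t) - wb t (X t) * Sxy (X t)).
    rewrite /Syy /Sxy !mulr_sumr -sumrB; apply: eq_bigr => j _.
    by rewrite /F /X; ring.
  by rewrite /wa /wb /G; ring.
have sum2 t : \sum_j cos (th j t) * F j t (X t) = V2 t * (G (X t) * D (X t)).
  transitivity (wb t (X t) * Sxx (X t) - wa t (X t) * Sxy (X t)).
    rewrite /Sxx /Sxy !mulr_sumr -sumrB; apply: eq_bigr => j _.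
    by rewrite /F /X; ring.
  by rewrite /wa /wb /G; ring.
(* the error made by the regularized equation vanishes *)
pose E t := sqdist (sum_map (angles (X t))) (c t).
pose e1 t := \sum_j cos (th j t) - Re (c t).
pose e2 t := \sum_j sin (th j t) - Im (c t).
have EE t : E t = e1 t ^+ 2 + e2 t ^+ 2 by rewrite /E /sqdist ReX ImX.
have V1E t : 0 <= t <= 1 -> V1 t = Re (velocity c t).
  by move=> /andP[t0 t1]; rewrite /V1 clampE //; apply/andP; split; lra.
have V2E t : 0 <= t <= 1 -> V2 t = Im (velocity c t).
  by move=> /andP[t0 t1]; rewrite /V2 clampE //; apply/andP; split; lra.
pose k t := G (X t) * D (X t) - 1.
have de1 (t : R) : 0 <= t <= 1 -> is_derive t 1 e1 (V1 t * k t).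
  move=> t01; have := is_deriveB1 (is_derive_sum1 (fun j => dcos j t)) (dc t).1.
  by rewrite sum1 -V1E // /k; congr is_derive; ring.
have de2 (t : R) : 0 <= t <= 1 -> is_derive t 1 e2 (V2 t * k t).
  move=> t01; have := is_deriveB1 (is_derive_sum1 (fun j => dsin j t)) (dc t).2.
  by rewrite sum2 -V2E // /k; congr is_derive; ring.
have kE t : 0 <= t <= 1 -> `|k t| <= e^-1 * E t.
  move=> t01; have := e0P t (angles (X t)) t01 (torus_angles _).
  rewrite -GE -/(E t) /k /D; set g := G _ => geE.
  have E0 : 0 <= E t by exact: sqdist_ge0.
  have g0 : 0 <= g by rewrite /g GE gram_ge0.
  have [ge|ge] := leP e g.
    rewrite divff ?subrr ?normr0 ?mulr_ge0 ?invr_ge0 // ?ltW //.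
    by rewrite gt_eqF // (lt_le_trans e_gt0).
  have -> : g / e - 1 = - (e^-1 * (e - g)) by field; rewrite gt_eqF.
  rewrite normrN ger0_norm ?mulr_ge0 ?invr_ge0 ?subr_ge0 ?(ltW ge) ?(ltW e_gt0) //.
  by rewrite ler_pM2l ?invr_gt0 //; move: geE; rewrite /e; lra.
have ce1 t : 0 <= t <= 1 -> {for t, continuous e1}.
  by move=> t01; exact: is_derive_continuous (de1 t t01).
have ce2 t : 0 <= t <= 1 -> {for t, continuous e2}.
  by move=> t01; exact: is_derive_continuous (de2 t t01).
pose f t := 2 * (e1 t * V1 t + e2 t * V2 t).
have cf t : 0 <= t <= 1 -> {for t, continuous f}.
  move=> t01; have f1 := cont_mul (ce1 t t01) (cV1 t).
  have f2 := cont_mul (ce2 t t01) (cV2 t).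
  exact: cont_mul (@cont_cst R R 2 t) (cont_add f1 f2).
have [K KP] := bounded_on_segment ler01 cf.
have E0 t : 0 <= t <= 1 -> E t = 0.
  apply: (@gronwall0 R E (fun t => f t * k t) 0 1 (K * e^-1)).
  - move=> s s01; have d1 := de1 s s01; have d2 := de2 s s01.
    have := is_deriveD1 (is_deriveM1 d1 d1) (is_deriveM1 d2 d2).
    rewrite (_ : E = fun t => e1 t * e1 t + e2 t * e2 t); last first.
      by apply/funext => x; rewrite EE !expr2.
    by congr is_derive; rewrite /f; ring.
  - by move=> s _; exact: sqdist_ge0.
  - move=> s s01; rewrite normrM -mulrA; apply: ler_pM => //; first exact: KP.
    exact: kE.
  - rewrite /E (_ : angles (X 0) = q) ?qc ?/sqdist ?subrr ?expr0n ?addr0 //.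
    by rewrite -x0q; congr angles; apply/funext => j; exact: th0.
have fE t : 0 <= t <= 1 -> sum_map (angles (X t)) = c t.
  by move=> t01; apply: sqdist_eq0; exact: E0.
have G_gt t : 0 <= t <= 1 -> e < G (X t).
  move=> t01; have := e0P t (angles (X t)) t01 (torus_angles _).
  rewrite -GE -/(E t) E0 // addr0; apply: lt_le_trans.
  by rewrite /e; lra.
have cG : continuous (fun t => G (X t)).
  move=> t; have cc j : {for t, continuous (fun s => cos (th j s))}.
    exact: is_derive_continuous (dcos j t).
  have cs j : {for t, continuous (fun s => sin (th j s))}.
    exact: is_derive_continuous (dsin j t).
  have cxx := cont_sum (fun j => cont_mul (cc j) (cc j)).
  have cyy := cont_sum (fun j => cont_mul (cs j) (cs j)).
  have cxy := cont_sum (fun j => cont_mul (cc j) (cs j)).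
  exact: cont_add (cont_mul cxx cyy) (cont_opp (cont_mul cxy cxy)).
pose A : set R := `]-1, 2[%classic `&` [set t | e < G (X t)].
have oA : open A.
  apply: openI; first exact: interval_open.
  apply: (@open_comp R R (fun t => G (X t)) [set x | e < x]); last exact: open_gt.
  by move=> t _; exact: cG.
have A01 : `[0, 1] `<=` A.
  move=> t; rewrite /= in_itv /= => t01; split; last exact: G_gt.
  by move/andP: t01 => [t0 t1]; rewrite /= in_itv /=; apply/andP; split; lra.
have AG t : A t -> G (X t) != 0 by move=> [_ /= /(lt_trans e_gt0)]; rewrite lt0r => /andP[].
pose W1 t := derive1 (fun s => Re (c s)) t; pose W2 t := derive1 (fun s => Im (c s)) t.
pose va t x := (W1 t * Sxx x + W2 t * Sxy x) * (G x)^-1.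
pose vb t x := (W1 t * Sxy x + W2 t * Syy x) * (G x)^-1.
pose rhs j t := vb t (X t) * cos (th j t) - va t (X t) * sin (th j t).
have FE j t : A t -> F j t (X t) = rhs j t.
  move=> [/= t12 tG]; rewrite /F /rhs /wa /wb /va /vb /D max_l; last exact: ltW.
  rewrite /V1 /V2 clampE // ; move: t12; rewrite in_itv /= => /andP[t1 t2].
  by rewrite !ltW.
have dthA j (t : R) : A t -> is_derive t 1 (th j) (rhs j t).
  by move=> At; rewrite -FE //; exact: dth.
have Cth n j : Ck n A (th j).
  elim: n j => [//|n IH] j; apply: (Ck_derive oA (dthA j)); rewrite /rhs.
  have [[_ C1] [_ C2]] := smooth_on_Ck sc n.+1.
  have CW1 : Ck n A W1 := Ck_sub (@subsetT _ A) C1.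
  have CW2 : Ck n A W2 := Ck_sub (@subsetT _ A) C2.
  have Cc i : Ck n A (fun t => cos (th i t)) by case: (Ck_cos_sin oA (IH i)).
  have Cs i : Ck n A (fun t => sin (th i t)) by case: (Ck_cos_sin oA (IH i)).
  have Cxx : Ck n A (fun t => Sxx (X t)).
    by apply: Ck_sum => // i; exact: CkM oA (Cc i) (Cc i).
  have Cxy : Ck n A (fun t => Sxy (X t)).
    by apply: Ck_sum => // i; exact: CkM oA (Cc i) (Cs i).
  have Cyy : Ck n A (fun t => Syy (X t)).
    by apply: Ck_sum => // i; exact: CkM oA (Cs i) (Cs i).
  have CG : Ck n A (fun t => (G (X t))^-1).
    exact: CkV oA AG (CkB oA (CkM oA Cxx Cyy) (CkM oA Cxy Cxy)).
  have Ca := CkM oA (CkD oA (CkM oA CW1 Cxx) (CkM oA CW2 Cxy)) CG.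
  have Cb := CkM oA (CkD oA (CkM oA CW1 Cxy) (CkM oA CW2 Cyy)) CG.
  exact: CkB oA (CkM oA Cb (Cc j)) (CkM oA Ca (Cs j)).
exists (fun t => angles (X t)); last first.
  by rewrite -x0q; congr angles; apply/funext => j; exact: th0.
split=> [t t01|].
  split; [exact: torus_angles|exact: fE|].
  have At : A t by apply: A01; rewrite /= in_itv.
  apply: (@horizontal_hvel _ _ _ (va t (X t) +i* vb t (X t))); first exact: torus_angles.
  move=> j; rewrite !mxE; apply: velocity_is.
    rewrite (_ : (fun s => Re _) = (fun s => cos (th j s))); last first.
      by apply/funext => s; rewrite mxE.
    by have := dcos j t; rewrite FE //; congr is_derive; rewrite /rhs /= /ang /=; ring.
  rewrite (_ : (fun s => Im _) = (fun s => sin (th j s))); last first.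
    by apply/funext => s; rewrite mxE.
  by have := dsin j t; rewrite FE //; congr is_derive; rewrite /rhs /= /ang /=; ring.
exists A; split=> // j; apply: Ck_smooth_on => n.
have [Cc Cs] := Ck_cos_sin oA (Cth n j).
split; first by apply: Ck_ext Cc => // t _; rewrite mxE.
by apply: Ck_ext Cs => // t _; rewrite mxE.
Qed.

End LiftExistence.

(** * Concatenation of lifts *)

Section Concatenation.
Context {R : realType} {m : nat}.
Local Notation C := R[i].
Local Notation V := 'rV[R[i]]_m.
Local Notation Re := complex.Re.
Local Notation Im := complex.Im.

(** The i-th function is run over [i / N, (i + 1) / N].  At t = 1 the truncation
    gives N, which the minimum brings back to the last piece. *)
Definition concat {X : Type} (N : nat) (f : nat -> R -> X) (t : R) : X :=
  let i := minn (Num.truncn (N%:R * t)) N.-1 in f i (N%:R * t - i%:R).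

Lemma concatE {X : Type} N (f : nat -> R -> X) i t : (i < N)%N ->
  (forall i, (i.+1 < N)%N -> f i 1 = f i.+1 0) ->
  i%:R / N%:R <= t <= i.+1%:R / N%:R -> concat N f t = f i (N%:R * t - i%:R).
Proof.
move=> iN fS; have N0 : 0 < N%:R :> R by rewrite ltr0n (leq_ltn_trans _ iN).
rewrite ler_pdivrMr // ler_pdivlMr // ![t * _]mulrC /concat => /andP[].
set s := N%:R * t => is_; rewrite le_eqVlt => /orP[/eqP sE|si].
  rewrite sE natrK; have [iN1|] := ltnP i.+1 N.
    rewrite (_ : minn _ _ = i.+1); last by apply/minn_idPl; rewrite -ltnS prednK // (leq_ltn_trans _ iN).
    by rewrite subrr -fS // -natr1 addrC addKr.
  move=> Ni; rewrite (_ : minn _ _ = i) //; have -> : N = i.+1 by apply/eqP; rewrite eqn_leq Ni.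
  exact/minn_idPr.
rewrite (_ : Num.truncn s = i); last by apply: truncn_def; rewrite is_.
by rewrite (_ : minn _ _ = i) //; apply/minn_idPl; rewrite -ltnS prednK // (leq_ltn_trans _ iN).
Qed.

Lemma concat0 {X : Type} N (f : nat -> R -> X) : (0 < N)%N ->
  (forall i, (i.+1 < N)%N -> f i 1 = f i.+1 0) -> concat N f 0 = f 0%N 0.
Proof.
move=> N0 fS; rewrite (@concatE _ _ _ 0) // ?mulr0 ?subr0 //.
by rewrite mul0r lexx mul1r invr_ge0 ler0n.
Qed.

Lemma concat1 {X : Type} N (f : nat -> R -> X) : (0 < N)%N ->
  (forall i, (i.+1 < N)%N -> f i 1 = f i.+1 0) -> concat N f 1 = f N.-1 1.
Proof.
case: N => // N _ fS; rewrite (@concatE _ _ _ N) // ?mulr1.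
  by rewrite -natr1 addrC addKr.
by rewrite divff ?pnatr_eq0 // lexx ler_pdivrMr ?ltr0n // mul1r ler_nat leqnSn.
Qed.

Lemma uniform_subdivision N : (0 < N)%N ->
  @subdivision R N (fun i => i%:R / N%:R).
Proof.
move=> N0; split; first by rewrite mul0r.
  by rewrite divff // pnatr_eq0 -lt0n.
by move=> i _; rewrite ltr_pM2r ?invr_gt0 ?ltr0n // ltr_nat.
Qed.

Lemma rescale_itv N i (t : R) : (i < N)%N -> i%:R / N%:R <= t <= i.+1%:R / N%:R ->
  0 <= N%:R * t - i%:R <= 1.
Proof.
move=> iN; have N0 : 0 < N%:R :> R by rewrite ltr0n (leq_ltn_trans _ iN).
rewrite ler_pdivrMr // ler_pdivlMr // ![t * _]mulrC -natr1 => /andP[a b].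
by rewrite subr_ge0 a lerBlDl.
Qed.

Lemma smooth_on_affine (A : set R) (g : R -> C) a b : open A -> smooth_on A g ->
  smooth_on [set t | A (a * t + b)] (fun t => g (a * t + b)).
Proof.
move=> oA sg; apply: Ck_smooth_on => n; have [C1 C2] := smooth_on_Ck sg n.
by split; [exact: (Ck_affine a b oA C1)|exact: (Ck_affine a b oA C2)].
Qed.

Lemma velocity_affine (A : set R) (g : R -> C) a b t : smooth_on A g ->
  A (a * t + b) ->
  velocity (fun s => g (a * s + b)) t = a%:C * velocity g (a * t + b).
Proof.
move=> sg At; have [d1 d2] := is_derive_velocity sg At.
apply: velocity_is; rewrite ?complex_ReM ?complex_ImM !mul0r ?subr0 ?addr0.
  exact: (is_derive_comp_affine d1).
exact: (is_derive_comp_affine d2).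
Qed.

Lemma horizontal_scale (z v : V) (a : R) : horizontal_space z v ->
  horizontal_space z (\row_j (a%:C * v ord0 j)).
Proof.
move=> [tv hv]; split=> [j|u ku].
  rewrite !mxE complex_ReM complex_ImM /= !mul0r subr0 addr0.
  by rewrite mulrCA [X in _ + X]mulrCA -mulrDr tv mulr0.
rewrite -[RHS](mulr0 a) -(hv u ku) /inner mulr_sumr; apply: eq_bigr => j _.
by rewrite mxE complex_ReM complex_ImM /=; ring.
Qed.

Lemma concat_smooth N (cs : nat -> R -> C) : (0 < N)%N ->
  (forall i, (i < N)%N -> smooth_on setT (cs i)) ->
  (forall i, (i.+1 < N)%N -> cs i 1 = cs i.+1 0) -> piecewise_smooth (concat N cs).
Proof.
move=> N0 sc cS; exists N, (fun i => i%:R / N%:R); split.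
  exact: uniform_subdivision.
move=> i iN; exists (fun t => cs i (N%:R * t + - i%:R)); split.
  exists setT; split=> //; first exact: openT.
  by have := smooth_on_affine (a := N%:R) (b := - i%:R) openT (sc i iN).
by move=> t tI; rewrite (concatE iN).
Qed.

Lemma concat_lift N (cs : nat -> R -> C) (zs : nat -> R -> V) : (0 < N)%N ->
  (forall i, (i < N)%N -> lift_piece (cs i) (zs i)) ->
  (forall i, (i.+1 < N)%N -> cs i 1 = cs i.+1 0) ->
  (forall i, (i.+1 < N)%N -> zs i 1 = zs i.+1 0) ->
  horizontal_lift (concat N cs) (concat N zs).
Proof.
move=> N0 lz cS zS; have usub := uniform_subdivision N0.
have H (P : R -> Prop) :
    (forall i t, (i < N)%N -> i%:R / N%:R <= t <= i.+1%:R / N%:R -> P t) ->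
    forall t, 0 <= t <= 1 -> P t.
  move=> PH; apply: (subdivision_ind usub) => [|i iN _ t]; last exact: PH.
  by apply: (PH 0%N) => //; rewrite mul0r lexx divr_ge0 ?ler0n.
split; [split|].
- apply: H => i t iN tI; rewrite (concatE iN zS tI).
  by have [+ _] := lz i iN => /(_ _ (rescale_itv iN tI)) [].
- exists N, (fun i => i%:R / N%:R); split=> // i iN.
  have [hz [A [oA sA smA]]] := lz i iN.
  exists (fun j t => zs i (N%:R * t + - i%:R) ord0 j); split=> [j|t tI].
    split; last by move=> t tI; rewrite (concatE iN zS tI).
    exists [set t | A (N%:R * t + - i%:R)]; split.
    + exact: open_affine.
    + move=> t; rewrite /= in_itv /= => tI; apply: sA.
      by rewrite /= in_itv /=; exact: rescale_itv iN tI.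
    + exact: (smooth_on_affine (g := fun s => zs i s ord0 j) oA (smA j)).
  have t01 := rescale_itv iN tI; have [_ _ hzt] := hz _ t01.
  rewrite (concatE iN zS tI); have := horizontal_scale N%:R hzt.
  congr horizontal_space; apply/rowP => j; rewrite !mxE.
  rewrite (velocity_affine (g := fun s => zs i s ord0 j) (smA j)) //.
  by apply: sA; rewrite /= in_itv.
- apply: H => i t iN tI; rewrite (concatE iN zS tI) (concatE iN cS tI).
  by have [+ _] := lz i iN => /(_ _ (rescale_itv iN tI)) [].
Qed.

(** Each piece is lifted from the endpoint of the lift of the preceding one. *)
Lemma lift_chain N (cs : nat -> R -> C) (q : V) : (0 < m)%N ->
  (0 < N)%N -> (forall i, (i < N)%N -> smooth_on setT (cs i)) ->
  (forall i, (i.+1 < N)%N -> cs i 1 = cs i.+1 0) ->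
  (forall i t, (i < N)%N -> 0 <= t <= 1 -> regular_value m (cs i t)) ->
  torus m q -> sum_map q = cs 0%N 0 ->
  exists zs : nat -> R -> V, [/\ zs 0%N 0 = q,
    forall i, (i < N)%N -> lift_piece (cs i) (zs i) &
    forall i, (i.+1 < N)%N -> zs i 1 = zs i.+1 0].
Proof.
move=> m0 N0 sc cS reg tq qc.
have /choice [L LP] : forall iz : nat * V, exists gam : R -> V,
    (iz.1 < N)%N -> torus m iz.2 -> sum_map iz.2 = cs iz.1 0 ->
    lift_piece (cs iz.1) gam /\ gam 0 = iz.2.
  move=> [i z] /=; have [[iN tz zc]|no] :=
    pselect [/\ (i < N)%N, torus m z & sum_map z = cs i 0].
    have [gam lg g0] := lift_exists m0 (sc i iN) (fun t => reg i t iN) tz zc.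
    by exists gam.
  by exists (fun=> z) => iN tz zc; case: no.
pose s := fix s n : V := if n is k.+1 then L (k, s k) 1 else q.
have i1 : 0 <= (1 : R) <= 1 by rewrite lexx ler01.
have sP i : (i < N)%N -> torus m (s i) /\ sum_map (s i) = cs i 0.
  elim: i => [//|i IH] iN; have [tz zc] := IH (ltnW iN).
  have [[lp _] _] := LP (i, s i) (ltnW iN) tz zc.
  by have [tz1 zc1 _] := lp 1 i1; split=> //=; rewrite zc1 cS.
exists (fun i => L (i, s i)); split=> [|i iN|i iN].
- by have [tz zc] := sP 0%N N0; case: (LP (0%N, s 0%N) N0 tz zc).
- by have [tz zc] := sP i iN; case: (LP (i, s i) iN tz zc).
- by have [tz zc] := sP i.+1 iN; case: (LP (i.+1, s i.+1) iN tz zc) => _ ->.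
Qed.

(** A prescribed lift of a loop from q is the lift of a holonomy: starting from the
    other points of the fibre, lifts are provided by [lift_chain]. *)
Lemma fixed_points_chain (b : C) (U : set C) (q : fiber m b) N
    (cs : nat -> R -> C) (zs : nat -> R -> V) :
  (0 < m)%N -> U `<=` regular_value m -> (0 < N)%N ->
  (forall i, (i < N)%N -> smooth_on setT (cs i)) ->
  (forall i, (i.+1 < N)%N -> cs i 1 = cs i.+1 0) ->
  (forall i t, (i < N)%N -> 0 <= t <= 1 -> U (cs i t)) ->
  cs 0%N 0 = b -> cs N.-1 1 = b ->
  (forall i, (i < N)%N -> lift_piece (cs i) (zs i)) ->
  (forall i, (i.+1 < N)%N -> zs i 1 = zs i.+1 0) ->
  zs 0%N 0 = \val q -> fixed_points m b U q -> zs N.-1 1 = \val q.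
Proof.
move=> m0 Ureg N0 sc cS cU c0 c1 lz zS z0 fq.
have i1 : 0 <= (1 : R) <= 1 by rewrite lexx ler01.
have endP ws : (forall i, (i < N)%N -> lift_piece (cs i) (ws i)) -> fiber m b (ws N.-1 1).
  have N1 : (N.-1 < N)%N by rewrite prednK.
  move=> lw; have [lp _] := lw N.-1 N1.
  by have [tw wc _] := lp 1 i1; split=> //; rewrite wc.
have /choice [phi phiP] : forall q' : fiber m b, exists q'' : fiber m b,
    (exists gam, [/\ horizontal_lift (concat N cs) gam, gam 0 = \val q' &
                     gam 1 = \val q'']) /\ (q' = q -> \val q'' = zs N.-1 1).
  move=> q'.
  have [ws [w0 lw wS wq]] : exists ws : nat -> R -> V, [/\ ws 0%N 0 = \val q',
      forall i, (i < N)%N -> lift_piece (cs i) (ws i),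
      forall i, (i.+1 < N)%N -> ws i 1 = ws i.+1 0 & q' = q -> ws = zs].
    have [->|nq] := pselect (q' = q); first by exists zs.
    have [tq sq] := set_valP q'.
    have [|ws [w0 lw wS]] := lift_chain m0 N0 sc cS (fun i t iN t01 => Ureg _ (cU i t iN t01)) tq.
      by rewrite sq c0.
    by exists ws.
  exists (SigSub (mem_set (endP ws lw))); split; last by move=> /wq wz; rewrite /= wz.
  exists (concat N ws); split; first exact: concat_lift.
    by rewrite concat0.
  by rewrite concat1.
rewrite -((phiP q).2 erefl); congr (\val _); apply: fq.
exists (concat N cs); last by move=> q'; case: (phiP q').
split; first exact: concat_smooth.
- by rewrite concat0.
- by rewrite concat1.
- apply: (subdivision_ind (uniform_subdivision N0)) => [|i iN _ t tI].
    by rewrite concat0 //; apply: cU; rewrite ?lexx ?ler01.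
  by rewrite (concatE iN cS tI); apply: cU => //; exact: rescale_itv tI.
Qed.

End Concatenation.

(** * Moebius boosts of the circle *)

Section Boosts.
Context {R : realType}.
Local Notation C := R[i].
Local Notation Re := complex.Re.
Local Notation Im := complex.Im.

Lemma smooth_onD (A : set R) (g h : R -> C) : open A ->
  smooth_on A g -> smooth_on A h -> smooth_on A (fun t => g t + h t).
Proof.
move=> oA sg sh; apply: Ck_smooth_on => n.
have [g1 g2] := smooth_on_Ck sg n; have [h1 h2] := smooth_on_Ck sh n.
split; [apply: Ck_ext (CkD oA g1 h1) | apply: Ck_ext (CkD oA g2 h2)] => // t _.
  by rewrite complex_ReD.
by rewrite complex_ImD.
Qed.

Lemma smooth_onM (A : set R) (g h : R -> C) : open A ->
  smooth_on A g -> smooth_on A h -> smooth_on A (fun t => g t * h t).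
Proof.
move=> oA sg sh; apply: Ck_smooth_on => n.
have [g1 g2] := smooth_on_Ck sg n; have [h1 h2] := smooth_on_Ck sh n.
split.
  apply: Ck_ext (CkB oA (CkM oA g1 h1) (CkM oA g2 h2)) => // t _.
  by rewrite complex_ReM.
apply: Ck_ext (CkD oA (CkM oA g1 h2) (CkM oA g2 h1)) => // t _.
by rewrite complex_ImM.
Qed.

Lemma smooth_onV (A : set R) (g : R -> C) : open A ->
  (forall t, A t -> g t != 0) -> smooth_on A g -> smooth_on A (fun t => (g t)^-1).
Proof.
move=> oA g0 sg; apply: Ck_smooth_on => n.
have [g1 g2] := smooth_on_Ck sg n.
have N : Ck n A (fun t => (Re (g t) * Re (g t) + Im (g t) * Im (g t))^-1).
  apply: CkV => // [t At|]; last exact: CkD oA (CkM oA g1 g1) (CkM oA g2 g2).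
  rewrite -!expr2 paddr_eq0 ?sqr_ge0 // !sqrf_eq0.
  apply/negP => /andP[/eqP e1 /eqP e2]; move: (g0 t At); rewrite (_ : g t = 0) ?eqxx //.
  exact: complexP.
split.
  apply: Ck_ext (CkM oA g1 N) => // t _; case: (g t) => a b /=.
  by rewrite !expr2.
apply: Ck_ext (CkN oA (CkM oA g2 N)) => // t _; case: (g t) => a b /=.
by rewrite !expr2.
Qed.

Lemma smooth_on_cst (A : set R) (a : C) : smooth_on A (fun=> a).
Proof. by apply: Ck_smooth_on => n; split; exact: Ck_cst. Qed.

Lemma smooth_on_real (A : set R) (f : R -> R) : (forall n, Ck n A f) ->
  smooth_on A (fun t => (f t)%:C).
Proof. by move=> Cf; apply: Ck_smooth_on => n; split; [exact: Cf|exact: Ck_cst]. Qed.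

Lemma smooth_on_sum (A : set R) m (g : 'I_m -> R -> C) : open A ->
  (forall j, smooth_on A (g j)) -> smooth_on A (fun t => \sum_j g j t).
Proof.
move=> oA sg; apply: Ck_smooth_on => n; split.
  apply: (Ck_ext (f := fun t => \sum_j Re (g j t))) => // [t _|].
    by rewrite complex_Re_sum.
  by apply: Ck_sum => // j; case: (smooth_on_Ck (sg j) n).
apply: (Ck_ext (f := fun t => \sum_j Im (g j t))) => // [t _|].
  by rewrite complex_Im_sum.
by apply: Ck_sum => // j; case: (smooth_on_Ck (sg j) n).
Qed.

Lemma velocityM (A : set R) (g h : R -> C) t : smooth_on A g -> smooth_on A h ->
  A t -> velocity (fun s => g s * h s) t = velocity g t * h t + g t * velocity h t.
Proof.
move=> sg sh At.
have [g1 g2] := is_derive_velocity sg At; have [h1 h2] := is_derive_velocity sh At.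
apply: velocity_is.
  rewrite (_ : (fun s => _) = fun s => Re (g s) * Re (h s) - Im (g s) * Im (h s)); last first.
    by apply/funext => s; rewrite complex_ReM.
  have := is_deriveB1 (is_deriveM1 g1 h1) (is_deriveM1 g2 h2).
  by congr is_derive; rewrite complex_ReD !complex_ReM; ring.
rewrite (_ : (fun s => _) = fun s => Re (g s) * Im (h s) + Im (g s) * Re (h s)); last first.
  by apply/funext => s; rewrite complex_ImM.
have := is_deriveD1 (is_deriveM1 g1 h2) (is_deriveM1 g2 h1).
by congr is_derive; rewrite complex_ImD !complex_ImM; ring.
Qed.

Lemma velocity_scale_add (f : R -> R) (d : R) (a b : C) (t : R) : is_derive t 1 f d ->
  velocity (fun s => b + (f s)%:C * a) t = d%:C * a.
Proof.
move=> df; apply: velocity_is.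
  rewrite (_ : (fun s => _) = fun s => Re b + f s * Re a); last first.
    by apply/funext => s; rewrite complex_ReD complex_ReM /= mul0r subr0.
  have := is_deriveD1 (is_derive_cst (Re b) t 1) (is_deriveM1 df (is_derive_cst (Re a) t 1)).
  by congr is_derive; rewrite complex_ReM /= mul0r; ring.
rewrite (_ : (fun s => _) = fun s => Im b + f s * Im a); last first.
  by apply/funext => s; rewrite complex_ImD complex_ImM /= mul0r addr0.
have := is_deriveD1 (is_derive_cst (Im b) t 1) (is_deriveM1 df (is_derive_cst (Im a) t 1)).
by congr is_derive; rewrite complex_ImM /= mul0r; ring.
Qed.

Lemma normc_conj (u : C) : `|conjc u| = `|u|.
Proof. by rewrite !normc_def; case: u => a b /=; rewrite sqrrN. Qed.

Lemma unit_conj (u : C) : `|u| = 1 -> u * conjc u = 1.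
Proof.
move=> /normc_eq1; case: u => a b /= n; apply: complexP => /=; last by ring.
by rewrite -n; ring.
Qed.

(** The horizontal fields are quadratic in z: they generate Moebius transformations
    of the disc. *)
Lemma hvel_unit (w z : C) : `|z| = 1 -> hvel w z + hvel w z = w - conjc w * z * z.
Proof.
move=> /normc_eq1; case: z => x y; case: w => a b /= n.
apply: complexP; rewrite /hvel /ang /= ?mul0r ?subr0 ?addr0.
  apply/eqP; rewrite -subr_eq0; apply/eqP.
  transitivity (a * (x ^+ 2 + y ^+ 2 - 1)); first by ring.
  by rewrite n subrr mulr0.
apply/eqP; rewrite -subr_eq0; apply/eqP.
transitivity (b * (x ^+ 2 + y ^+ 2 - 1)); first by ring.
by rewrite n subrr mulr0.
Qed.

(** The Moebius transformation of the unit circle which moves the centre of the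
    disc to a along a geodesic. *)
Definition boost (a z : C) : C := (z + a) / (1 + conjc a * z).

(** The pole of the transformation is outside the closed disc. *)
Lemma boost_den (a z : C) : `|z| = 1 -> `|a| < 1 -> 1 + conjc a * z != 0.
Proof.
move=> z1 a1; apply/eqP => /eqP; rewrite addr_eq0 => /eqP e.
by move: a1; rewrite -[`|a|]mulr1 -{1}z1 -normc_conj -normrM -[conjc a * z]opprK -e normrN normr1 ltxx.
Qed.

Lemma boost_norm (a z : C) : `|z| = 1 -> `|a| < 1 -> `|boost a z| = 1.
Proof.
move=> z1 a1; have D0 := boost_den z1 a1.
have zE : 1 + conjc a * z = z * conjc (z + a).
  by rewrite rmorphD mulrDr (unit_conj z1) [z * _]mulrC.
rewrite /boost normrM normfV zE normrM z1 mul1r normc_conj divff //.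
by apply: contraNN D0; rewrite zE normr_eq0 => /eqP ->; rewrite conjc0 mulr0.
Qed.

Lemma boost0 (z : C) : boost 0 z = z.
Proof. by rewrite /boost conjc0 mul0r !addr0 divr1. Qed.

Lemma boost_dist (a z : C) : `|z| = 1 -> `|a| <= 1 / 2 ->
  `|boost a z - z| <= 4 * `|a|.
Proof.
move=> z1 a2.
have a1 : `|a| < 1.
  by apply: le_lt_trans a2 _; rewrite ltr_pdivrMr ?ltr0n // mul1r ltr1n.
have D0 := boost_den z1 a1.
have -> : boost a z - z = (a - conjc a * z * z) / (1 + conjc a * z).
  by rewrite /boost; field.
have D2 : 1 / 2 <= `|1 + conjc a * z|.
  have : 1 - `|conjc a * z| <= `|1 + conjc a * z|.
    by have := lerB_normD (1 : C) (conjc a * z); rewrite normr1.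
  apply: le_trans; rewrite normrM normc_conj z1 mulr1 lerBrDr.
  apply: le_trans (_ : 1 / 2 + 1 / 2 <= _); first by rewrite lerD2l.
  by rewrite -splitr.
have N : `|a - conjc a * z * z| <= 2 * `|a|.
  apply: le_trans (ler_normB _ _) _; rewrite !normrM normc_conj z1 !mulr1.
  by rewrite mulr_natl.
rewrite normrM normfV ler_pdivrMr ?normr_gt0 //; apply: le_trans N _.
have -> : (2 : C) * `|a| = 4 * `|a| * (1 / 2) by field.
by apply: ler_wpM2l => //; rewrite mulr_ge0.
Qed.

Lemma conjc_den (a b : C) : conjc (1 + conjc a * b) = 1 + a * conjc b.
Proof. by case: a b => [p q] [r s]; apply: complexP => /=; ring. Qed.

Lemma conjc_center (a b : C) : conjc (- ((a + b) / (1 + conjc a * b))) =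
  - ((conjc a + conjc b) / (1 + a * conjc b)).
Proof. by rewrite rmorphN rmorphM rmorphD /= conjc_inv conjc_den. Qed.

(** In the group of Moebius transformations of the disc, the product of the boosts by
    a and b is the boost by the image of b under the boost by a, up to a
    rotation. *)
Lemma boost_comp (a b z : C) : `|z| = 1 -> `|a| < 1 -> `|b| < 1 ->
  `|(a + b) / (1 + conjc a * b)| < 1 ->
  boost (- ((a + b) / (1 + conjc a * b))) (boost a (boost b z)) =
  (1 + a * conjc b) / (1 + conjc a * b) * z.
Proof.
move=> z1 a1 b1 g1.
have D1 := boost_den z1 b1; have z1' := boost_norm z1 b1.
have D2 := boost_den z1' a1; have z2' := boost_norm z1' a1.
have D3 : 1 + conjc (- ((a + b) / (1 + conjc a * b))) * boost a (boost b z) != 0.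
  by apply: boost_den => //; rewrite normrN.
have D4 : 1 + conjc a * b != 0.
  apply/eqP => e; move/eqP: e; rewrite addr_eq0 => /eqP e.
  have : `|conjc a * b| < 1.
    rewrite normrM normc_conj -[ltRHS]mulr1; apply: ltr_pM => //.
  by rewrite -[conjc a * b]opprK -e normrN normr1 ltxx.
have D5 : 1 + a * conjc b != 0.
  by rewrite -conjc_den conjc_eq0.
move: D3; rewrite /boost !conjc_center; move: D1 D2; rewrite /boost => D1 D2 D3.
move: D1 D2 D3 D4 D5.
move: (conjc a) (conjc b) => a' b' D1 D2 D3 D4 D5.
pose Q := (1 + a' * b) + (a' + b') * z.
have QE : Q = (1 + b' * z) * (1 + a' * ((z + b) / (1 + b' * z))).
  by rewrite /Q; field.
have Q0 : Q != 0 by rewrite QE mulf_neq0.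
have z2E : ((z + b) / (1 + b' * z) + a) / (1 + a' * ((z + b) / (1 + b' * z))) =
    ((1 + a * b') * z + (a + b)) / Q.
  by rewrite /Q; field; apply/andP; split; [exact: Q0|exact: D1].
move: D3; rewrite z2E => D3.
pose D := (1 + a * b') * (1 + a' * b) - (a + b) * (a' + b').
have D3E : 1 + - ((a' + b') / (1 + a * b')) * (((1 + a * b') * z + (a + b)) / Q) =
    D / ((1 + a * b') * Q).
  by rewrite /D /Q; field; apply/andP; split; [exact: Q0|exact: D5].
have D0 : D != 0.
  by move: D3; rewrite D3E mulf_eq0 negb_or => /andP[].
rewrite D3E.
have -> : ((1 + a * b') * z + (a + b)) / Q + - ((a + b) / (1 + a' * b)) =
    D * z / ((1 + a' * b) * Q).
  by rewrite /D /Q; field; apply/andP; split; [exact: Q0|exact: D4].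
by field; apply/and4P.
Qed.

End Boosts.

(** * Boosts as horizontal curves *)

Section BoostLift.
Context {R : realType} {m : nat}.
Local Notation C := R[i].
Local Notation V := 'rV[R[i]]_m.
Local Notation Re := complex.Re.
Local Notation Im := complex.Im.

(** A smooth function on the whole line with values in [-1, 1], which goes from 0
    to 1 on [0, 1]. *)
Definition ramp (t : R) : R := 2 * t / (1 + t ^+ 2).

Lemma ramp_den (t : R) : 1 + t ^+ 2 != 0.
Proof. by rewrite gt_eqF // ltr_pwDl // sqr_ge0. Qed.

Lemma ramp_smooth n : Ck n setT ramp.
Proof.
have oT : open [set: R] := openT.
have Ct : Ck n setT (fun t : R => t) := Ck_id n oT.
apply: CkM => //; first exact: CkM oT (Ck_cst n _ 2) Ct.
apply: CkV => // [t _|]; first exact: ramp_den.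
exact: CkD oT (Ck_cst n _ 1) (CkM oT Ct Ct).
Qed.

Lemma ramp_le1 (t : R) : `|ramp t| <= 1.
Proof.
rewrite /ramp normrM normfV [`|1 + _|]gtr0_norm ?ltr_pwDl ?sqr_ge0 //.
rewrite ler_pdivrMr ?ltr_pwDl ?sqr_ge0 // mul1r ler_norml.
have := sqr_ge0 (1 + t); have := sqr_ge0 (1 - t).
by rewrite !expr2 => h1 h2; apply/andP; split; lra.
Qed.

Lemma ramp0 : ramp 0 = 0. Proof. by rewrite /ramp mulr0 mul0r. Qed.
Lemma ramp1 : ramp 1 = 1. Proof. by rewrite /ramp expr1n mulr1 divff. Qed.

Definition boost_path (a : C) (z : V) (t : R) : V :=
  \row_j boost ((ramp t)%:C * a) (z ord0 j).

Lemma ramp_scale_norm (a : C) t : `|(ramp t)%:C * a| <= `|a|.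
Proof.
rewrite normrM -[leRHS]mul1r ler_wpM2r // normc_def /= expr0n addr0 sqrtr_sqr.
by rewrite (_ : (1 : C) = 1%:C) // lecR ramp_le1.
Qed.

Lemma hvel_scale (r : R) (w z : C) : hvel (r%:C * w) z = r%:C * hvel w z.
Proof. by case: w z => [a b] [x y]; apply: complexP; rewrite /hvel /ang /=; ring. Qed.

Lemma conjc_scale (r : R) (a : C) : conjc (r%:C * a) = r%:C * conjc a.
Proof. by case: a => p q; apply: complexP => /=; ring. Qed.

Definition boost_speed (a : C) (t : R) : R :=
  2 * (derive1 ramp t / (1 - ramp t ^+ 2 * (Re a ^+ 2 + Im a ^+ 2))).

(** With A := ramp(t) a, the point g of the path satisfies g (1 + conj(A) z) = z + A;
    the derivative of this relation gives a velocity proportional to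
    a - conj(a) g^2, with a real factor that does not depend on z.  Independence
    of z is what makes the motion of a whole configuration horizontal. *)
Lemma boost_velocity (a z : C) t : `|z| = 1 -> `|a| < 1 ->
  let g s := boost ((ramp s)%:C * a) z in
  smooth_on setT g /\ velocity g t = hvel ((boost_speed a t)%:C * a) (g t).
Proof.
move=> z1 a1 g.
have A1 s : `|(ramp s)%:C * a| < 1 by apply: le_lt_trans (ramp_scale_norm a s) a1.
pose N s : C := z + (ramp s)%:C * a.
pose D s : C := 1 + (ramp s)%:C * (conjc a * z).
have DE s : D s = 1 + conjc ((ramp s)%:C * a) * z.
  by rewrite /D conjc_scale mulrA.
have D0 s : D s != 0 by rewrite DE; exact: boost_den.
have gE s : g s = N s / D s by rewrite /g /boost DE.
have oT : open [set: R] := openT.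
have sr : smooth_on setT (fun s => (ramp s)%:C) := smooth_on_real ramp_smooth.
have sN : smooth_on setT N.
  exact: smooth_onD oT (smooth_on_cst z) (smooth_onM oT sr (smooth_on_cst a)).
have sD : smooth_on setT D.
  exact: smooth_onD oT (smooth_on_cst 1) (smooth_onM oT sr (smooth_on_cst (conjc a * z))).
have sg : smooth_on setT g.
  rewrite (_ : g = fun s => N s * (D s)^-1); last by apply/funext => s; exact: gE.
  exact: smooth_onM oT sN (smooth_onV oT (fun s _ => D0 s) sD).
split=> //.
have gD s : g s * D s = N s by rewrite gE divfK.
pose d := derive1 ramp t.
have dr : is_derive t 1 ramp d := Ck_is_derive (ramp_smooth 1) (I : setT t).
have vD : velocity g t * D t = d%:C * a - g t * (d%:C * (conjc a * z)).
  rewrite -(velocity_scale_add a z dr) -(velocity_scale_add (conjc a * z) 1 dr).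
  have -> : (fun s => z + (ramp s)%:C * a) = (fun s => g s * D s).
    by apply/funext => s; rewrite gD.
  by rewrite (velocityM sg sD (I : setT t)) addrK.
pose n2 := Re a ^+ 2 + Im a ^+ 2.
have n2E : n2%:C = a * conjc a.
  by rewrite /n2; case: a {a1 g A1 N D DE D0 gE sN sD sg gD vD n2} => p q;
    apply: complexP => /=; ring.
pose k := 1 - ramp t ^+ 2 * n2.
have kE : k%:C = 1 - (ramp t)%:C ^+ 2 * (a * conjc a).
  by rewrite /k rmorphB rmorph1 rmorphM rmorphXn -n2E.
have k0 : k != 0.
  apply/eqP => k0; have : `|(ramp t)%:C * a| ^+ 2 = 1.
    rewrite -[LHS]add_Re2_Im2 complex_ReM complex_ImM /= !mul0r subr0 addr0 -[RHS]/(1%:C).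
    by congr (_%:C); apply/eqP; rewrite -subr_eq0 -oppr_eq0 -k0 /k /n2; apply/eqP; ring.
  move=> e; have : `|(ramp t)%:C * a| ^+ 2 < 1 by rewrite expr_lt1.
  by rewrite e ltxx.
rewrite hvel_scale /boost_speed -/n2 -/k -/d; rewrite rmorphM /= -mulrA.
have -> : 2%:C * ((d / k)%:C * hvel a (g t)) = (d / k)%:C * (hvel a (g t) + hvel a (g t)).
  by rewrite mulrCA rmorph_nat mulr_natl.
rewrite hvel_unit; last exact: boost_norm.
have kC0 : k%:C != 0 by rewrite -[0]/(0%:C) (inj_eq (@complexI R)).
apply: (mulIf (D0 t)); apply: (mulIf kC0); rewrite vD.
rewrite rmorphM fmorphV /= kE.
have gD' : g t * (1 + (ramp t)%:C * (conjc a * z)) = z + (ramp t)%:C * a by exact: gD.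
rewrite kE in kC0; rewrite /D.
move: (g t) (conjc a) (ramp t)%:C d%:C gD' kC0 => u a' T e uD kC0.
have -> : e / (1 - T ^+ 2 * (a * a')) * (a - a' * u * u) * (1 + T * (a' * z)) *
    (1 - T ^+ 2 * (a * a')) = e * (a - a' * u * u) * (1 + T * (a' * z)) by field.
apply/eqP; rewrite -subr_eq0; apply/eqP.
transitivity (e * (T * a * a' + a' * u) *
  (u * (1 + T * (a' * z)) - (z + T * a))); first by ring.
by rewrite uD subrr mulr0.
Qed.

Lemma boost_path_lift (a : C) (z : V) : torus m z -> `|a| < 1 ->
  lift_piece (fun t => sum_map (boost_path a z t)) (boost_path a z) /\
  smooth_on setT (fun t => sum_map (boost_path a z t)).
Proof.
move=> tz a1.
have bE j : (fun s => boost_path a z s ord0 j) =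
    (fun s => boost ((ramp s)%:C * a) (z ord0 j)) by apply/funext => s; rewrite mxE.
have bs j : smooth_on setT (fun s => boost_path a z s ord0 j).
  by rewrite bE; case: (boost_velocity 0 (tz j) a1).
split; last exact: smooth_on_sum openT bs.
have tb t : torus m (boost_path a z t).
  move=> j; rewrite mxE; apply: boost_norm => //.
  exact: le_lt_trans (ramp_scale_norm a t) a1.
split=> [t _|]; last by exists setT; split=> //; exact: openT.
split=> //.
apply: (horizontal_hvel (w := (boost_speed a t)%:C * a) (tb t)) => j.
by rewrite !mxE bE; case: (boost_velocity t (tz j) a1).
Qed.

End BoostLift.

(** * A rotation as a product of boosts *)

Section Rotation.
Context {R : realType}.
Local Notation C := R[i].
Local Notation Re := complex.Re.
Local Notation Im := complex.Im.

(** A rational parametrization of the unit circle: rho(tan(x / 2)) = exp(i x). *)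
Definition rho (s : R) : C := (1 +i* s) / (1 -i* s).

Lemma rho_den (s : R) : (1 -i* s : C) != 0 /\ (1 +i* s : C) != 0.
Proof. by split; rewrite eq_complex /= oner_eq0. Qed.

Lemma rho_neq0 s : rho s != 0.
Proof. by rewrite mulf_neq0 ?invr_eq0; case: (rho_den s). Qed.

Lemma rho0 : rho 0 = 1.
Proof.
by rewrite /rho oppr0 divff //; case: (rho_den 0).
Qed.

Lemma rho_smooth (a : R) : smooth_on setT (fun t => rho (a * t)).
Proof.
have oT : open [set: R] := openT.
have Ca n : Ck n setT (fun t : R => a * t) := CkM oT (Ck_cst n _ a) (Ck_id n oT).
apply: smooth_onM => //; last apply: smooth_onV => // [t _|].
- by apply: Ck_smooth_on => n; split; [exact: Ck_cst|exact: Ca].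
- by case: (rho_den (a * t)).
- by apply: Ck_smooth_on => n; split; [exact: Ck_cst|apply: CkN].
Qed.

Lemma rho_dist (s : R) : `|rho s - 1| <= (2 * `|s|)%:C.
Proof.
have [d0 _] := rho_den s.
have -> : rho s - 1 = (0 +i* (2 * s)) / (1 -i* s).
  rewrite /rho -[X in _ - X](divff d0) -mulrBl; congr (_ / _).
  by apply: complexP => /=; ring.
rewrite normrM normfV ler_pdivrMr ?normr_gt0 // !normc_def /= expr0n add0r sqrtr_sqr.
rewrite -[X in _ <= X]rmorphM /= lecR normrM [`|2|]ger0_norm //.
rewrite ler_peMr ?mulr_ge0 // -[leLHS]sqrtr1 ler_wsqrtr //.
by rewrite expr1n lerDl sqr_ge0.
Qed.

(** Boosts by e, by i e and back to the centre run around a small geodesic triangle of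
    the hyperbolic plane, whose holonomy is a rotation by an angle of order
    e ^ 2. *)
Lemma boost_rotation (e : R) (z : C) : `|z| = 1 -> 0 <= e -> e <= 1 / 4 ->
  let a := e%:C in let b := 0 +i* e in
  let g := (a + b) / (1 + conjc a * b) in
  [/\ `|a| <= e%:C, `|b| <= e%:C, `|g| <= (2 * e)%:C &
      boost (- g) (boost a (boost b z)) = (rho (e ^+ 2))^-1 * z].
Proof.
move=> z1 e0 e4 a b g.
have aE : `|a| = e%:C by rewrite normc_def /= expr0n addr0 sqrtr_sqr ger0_norm.
have bE : `|b| = e%:C by rewrite normc_def /= expr0n add0r sqrtr_sqr ger0_norm.
have den : 1 + conjc a * b = 1 +i* (e ^+ 2).
  by rewrite /a /b; apply: complexP => /=; ring.
have den' : 1 + a * conjc b = 1 -i* (e ^+ 2).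
  by rewrite /a /b; apply: complexP => /=; ring.
have den1 : 1 <= `|1 +i* (e ^+ 2) : C|.
  rewrite normc_def (_ : (1 : C) = 1%:C) // lecR /= -[leLHS]sqrtr1 ler_wsqrtr //.
  by rewrite expr1n lerDl sqr_ge0.
have gE : `|g| <= (2 * e)%:C.
  rewrite /g den normrM normfV ler_pdivrMr ?(lt_le_trans ltr01 den1) //.
  apply: le_trans (ler_normD _ _) _; rewrite aE bE.
  rewrite -rmorphD /= -[leLHS]mulr1 (_ : e + e = 2 * e); last by ring.
  by apply: ler_pM => //; rewrite ler0c mulr_ge0.
split; rewrite ?aE ?bE //.
have e1 : e%:C < 1 by rewrite (_ : (1 : C) = 1%:C) // ltcR; lra.
rewrite boost_comp // ?aE ?bE //; last first.
  by apply: le_lt_trans gE _; rewrite (_ : (1 : C) = 1%:C) // ltcR; lra.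
by rewrite den den' /rho invf_div.
Qed.

End Rotation.

(** * The rotating lift through a fixed configuration *)

Section FixedPoints.
Context {R : realType} {m : nat}.
Local Notation C := R[i].
Local Notation V := 'rV[R[i]]_m.
Local Notation Re := complex.Re.
Local Notation Im := complex.Im.

Lemma lift_piece_rescale (c : R -> C) (gam : R -> V) (s : R) : 0 <= s <= 1 ->
  lift_piece c gam -> lift_piece (fun t => c (s * t)) (fun t => gam (s * t)).
Proof.
move=> /andP[s0 s1] [hz [A [oA sA smA]]].
have itv t : 0 <= t <= 1 -> 0 <= s * t <= 1.
  by move=> /andP[t0 t1]; rewrite mulr_ge0 //= -[leRHS]mulr1 ler_pM.
have E j : (fun t => gam (s * t) ord0 j) = (fun t => gam (s * t + 0) ord0 j).
  by apply/funext => t; rewrite addr0.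
split=> [t t01|].
  have [tz zc hzt] := hz _ (itv t t01); split=> //.
  have := horizontal_scale s hzt; congr horizontal_space; apply/rowP => j.
  rewrite !mxE E (velocity_affine (g := fun s => gam s ord0 j) (smA j)) addr0 //.
  by apply: sA; rewrite /= in_itv; exact: itv.
exists [set t | A (s * t + 0)]; split; first exact: open_affine.
  by move=> t; rewrite /= in_itv /= => t01; apply: sA; rewrite addr0 /= in_itv; exact: itv.
move=> j; rewrite E.
exact: (smooth_on_affine (g := fun s => gam s ord0 j) oA (smA j)).
Qed.

Lemma open_ball (U : set C) (b : C) : open (U : set R[i]^o) -> U b ->
  exists2 r : R, 0 < r & forall z, `|z - b| < r%:C -> U z.
Proof.
move=> oU Ub; have := open_nbhs_nbhs (conj oU Ub).
move=> /(@nbhs_ballP C R[i]^o) [e /= e0 eU].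
have eE : e = (Re e)%:C.
  by case: e e0 eU => p q; rewrite ltcE /= => /andP[/eqP -> _].
exists (Re e); first by move: e0; rewrite ltcE => /andP[].
by move=> z zb; apply: eU; rewrite /ball /= eE distrC.
Qed.

Lemma dist_trans (u v w : C) (x y : R) : `|u - v| <= x%:C -> `|v - w| <= y%:C ->
  `|u - w| <= (x + y)%:C.
Proof.
move=> uv vw; have -> : u - w = (u - v) + (v - w) by rewrite addrA subrK.
by rewrite rmorphD /=; apply: le_trans (ler_normD _ _) (lerD uv vw).
Qed.

Lemma boost_path_dist (a : C) (z : V) t (e : R) : torus m z -> e <= 1 / 2 ->
  `|a| <= e%:C ->
  `|sum_map (boost_path a z t) - sum_map z| <= (4 * m%:R * e)%:C.
Proof.
move=> tz e2 ae; rewrite /sum_map -sumrB; apply: le_trans (ler_norm_sum _ _ _) _.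
apply: (@le_trans _ _ (\sum_(j < m) (4 * e)%:C)).
  apply: ler_sum => j _; rewrite mxE.
  have re := le_trans (ramp_scale_norm a t) ae.
  apply: le_trans (boost_dist (tz j) _) _.
    apply: le_trans re _.
    have -> : (1 / 2 : C) = (1 / 2)%:C by rewrite rmorphM fmorphV /= rmorph1 rmorph_nat.
    by rewrite lecR.
  have -> : (4 * e)%:C = 4 * e%:C by rewrite rmorphM /= rmorph_nat.
  by apply: ler_wpM2l.
by rewrite sumr_const card_ord -rmorphMn /= lecR -mulr_natr; lra.
Qed.

Lemma boost_path0 (a : C) (z : V) : boost_path a z 0 = z.
Proof. by apply/rowP => j; rewrite mxE ramp0 mul0r boost0. Qed.

Lemma boost_path1 (a : C) (z : V) j : boost_path a z 1 ord0 j = boost a (z ord0 j).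
Proof. by rewrite mxE ramp1 mul1r. Qed.

(** Lift the arc t |-> rho(eta t) b from q, stop at time s, and close the loop by the
    three boosts whose product is the rotation by rho(eta s)^-1.  This composite
    ends over b, and it stays in U when eta and s are small.  If q is fixed, it ends
    at q, so the lift of the arc at time s is q rotated by rho(eta s). *)
Lemma fixed_rotated_lift (b : C) (U : set C) (q : fiber m b) : (0 < m)%N ->
  open (U : set R[i]^o) -> U `<=` regular_value m -> U b -> fixed_points m b U q ->
  exists (eta t0 : R) (c : R -> C) (gam : R -> V),
    [/\ 0 < eta, 0 < t0 <= 1, lift_piece c gam, (forall t, 0 <= t <= 1 -> U (c t)) &
     forall t j, 0 < t < t0 ->
       gam t ord0 j = rho (eta * t) * (\val q : V) ord0 j].
Proof.
move=> m0 oU Ureg Ub fq; have [r r0 rU] := open_ball oU Ub.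
have [tq sq] := set_valP q.
pose nb := Num.sqrt (Re b ^+ 2 + Im b ^+ 2).
have nb0 : 0 <= nb by exact: sqrtr_ge0.
have nbE : `|b| = nb%:C by exact: normc_def.
(* with this choice, 2 eta |b| <= r / 2 *)
pose eta := r / (4 * (nb + 1)).
have nb1 : 0 < 4 * (nb + 1) by lra.
have eta0 : 0 < eta by rewrite divr_gt0.
have etaE : 4 * eta * nb + 4 * eta = r by rewrite /eta; field; lra.
have rhob t : 0 <= t <= 1 -> `|rho (eta * t) * b - b| <= (r / 2)%:C.
  move=> /andP[t0 t1]; rewrite -[X in _ - X]mul1r -mulrBl normrM nbE.
  apply: (@le_trans _ _ ((2 * `|eta * t|)%:C * nb%:C)).
    by rewrite ler_wpM2r ?ler0c //; exact: rho_dist.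
  have et0 : 0 <= eta * t := mulr_ge0 (ltW eta0) t0.
  have et1 : eta * t <= eta by rewrite -[leRHS]mulr1 ler_pM2l.
  rewrite -rmorphM /= lecR ger0_norm //.
  nra.
have close u x : `|u - b| <= x%:C -> x < r -> U u.
  by move=> ux xr; apply: rU; apply: le_lt_trans ux _; rewrite ltcR.
pose c0 t := rho (eta * t) * b.
have sc0 : smooth_on setT c0.
  exact: smooth_onM openT (rho_smooth eta) (smooth_on_cst b).
have c0U : forall t, 0 <= t <= 1 -> U (c0 t).
  move=> t t01; apply: (close _ _ (rhob t t01)).
  lra.
have c00 : c0 0 = b by rewrite /c0 mulr0 rho0 mul1r.
have [|gam lg g0] := lift_exists m0 sc0 (fun t t01 => Ureg _ (c0U t t01)) tq.
  by rewrite sq c00.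
have mR0 : 0 < m%:R :> R by rewrite ltr0n.
(* the three boosts move the sum by at most 4 m e, 4 m e and 8 m e *)
pose e0 := Num.min (1 / 4) (r / (64 * m%:R)).
have e00 : 0 < e0 by rewrite lt_min !divr_gt0 // mulr_gt0.
have e04 : e0 <= 1 / 4 by rewrite ge_min lexx.
have e0r : e0 * (64 * m%:R) <= r.
  by rewrite -ler_pdivlMr ?mulr_gt0 // ge_min lexx orbT.
pose t0 := Num.min 1 (e0 ^+ 2 / eta).
have t00 : 0 < t0 by rewrite lt_min ltr01 divr_gt0 // exprn_gt0.
exists eta, t0, c0, gam; split=> //; first by rewrite t00 ge_min lexx.
move=> s j /andP[s0 st].
have s1 : s <= 1 by apply: le_trans (ltW st) _; rewrite ge_min lexx.
have s01 : 0 <= s <= 1 by rewrite ltW.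
have es : eta * s <= e0 ^+ 2.
  rewrite mulrC -ler_pdivlMr //; apply: le_trans (ltW st) _.
  by rewrite ge_min lexx orbT.
(* [boost_rotation] with this e undoes rho (eta * s) *)
pose e := Num.sqrt (eta * s).
have eta_s : 0 <= eta * s by rewrite mulr_ge0 // ltW.
have eE : e ^+ 2 = eta * s by rewrite sqr_sqrtr.
have e_ge0 : 0 <= e := sqrtr_ge0 _.
have e_le : e <= e0 by rewrite -ler_sqr ?nnegrE ?(ltW e00) // eE.
have e4 : e <= 1 / 4 := le_trans e_le e04.
have er : e * (64 * m%:R) <= r.
  by apply: le_trans e0r; rewrite ler_wpM2r // mulr_ge0.
have [elt1 e2lt1 e2 e2'] : [/\ e < 1, 2 * e < 1, e <= 1 / 2 & 2 * e <= 1 / 2].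
  by clear -e4 r0; split; lra.
have [budget1 budget2 budget3] : [/\ 4 * m%:R * e + r / 2 < r,
    4 * m%:R * e + (4 * m%:R * e + r / 2) < r &
    4 * m%:R * (2 * e) + (4 * m%:R * e + (4 * m%:R * e + r / 2)) < r].
  have er' : e * m%:R * 64 <= r by rewrite -mulrA [m%:R * _]mulrC.
  have mr : 0 <= e * m%:R by rewrite mulr_ge0.
  by clear -er' mr r0; split; lra.
pose z0 := gam s.
have [tz0 sz0 _] := lg.1 s s01.
pose al : C := e%:C; pose be : C := 0 +i* e.
(* the boost by g carries the centre to the image of be under the boost by al *)
pose g : C := (al + be) / (1 + conjc al * be).
have rot (z : C) (nz : `|z| = 1) := boost_rotation nz e_ge0 e4.
have [al1 be1 g1 _] := rot 1 (normr1 _).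
have lt1 (x : C) (y : R) : `|x| <= y%:C -> y < 1 -> `|x| < 1.
  by move=> xy y1; apply: le_lt_trans xy _; rewrite (_ : (1 : C) = 1%:C) // ltcR.
have al_lt1 : `|al| < 1 := lt1 _ _ al1 elt1.
have be_lt1 : `|be| < 1 := lt1 _ _ be1 elt1.
have g_lt1 : `|- g| < 1 by rewrite normrN; exact: lt1 _ _ g1 e2lt1.
pose z1 := boost_path be z0 1; pose z2 := boost_path al z1 1.
pose z3 := boost_path (- g) z2 1.
have [l1 s1'] := boost_path_lift tz0 be_lt1.
have i1 : 0 <= (1 : R) <= 1 by rewrite lexx ler01.
have tz1 : torus m z1 by case: (l1.1 1 i1).
have [l2 s2'] := boost_path_lift tz1 al_lt1.
have tz2 : torus m z2 by case: (l2.1 1 i1).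
have [l3 s3'] := boost_path_lift tz2 g_lt1.
have z3E i : z3 ord0 i = (rho (eta * s))^-1 * z0 ord0 i.
  rewrite /z3 boost_path1 /z2 boost_path1 /z1 boost_path1 -eE.
  by have [_ _ _] := rot _ (tz0 i).
pose cs (i : nat) : R -> C := match i with
  | 0 => fun t => c0 (s * t)
  | 1 => fun t => sum_map (boost_path be z0 t)
  | 2 => fun t => sum_map (boost_path al z1 t)
  | _ => fun t => sum_map (boost_path (- g) z2 t) end.
pose zs (i : nat) : R -> V := match i with
  | 0 => fun t => gam (s * t)
  | 1 => boost_path be z0
  | 2 => boost_path al z1
  | _ => boost_path (- g) z2 end.
have smooth_cs : forall i, (i < 4)%N -> smooth_on setT (cs i).
  have E : (fun t => c0 (s * t)) = (fun t => c0 (s * t + 0)).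
    by apply/funext => t; rewrite addr0.
  move=> [|[|[|[|//]]]] _; [|exact: s1'|exact: s2'|exact: s3'].
  by rewrite /cs E; exact: (smooth_on_affine (a := s) (b := 0) openT sc0).
have match_cs : forall i, (i.+1 < 4)%N -> cs i 1 = cs i.+1 0.
  move=> [|[|[|//]]] _; rewrite /cs.
  - by rewrite boost_path0 mulr1 -sz0.
  - by rewrite boost_path0.
  - by rewrite boost_path0.
have match_zs : forall i, (i.+1 < 4)%N -> zs i 1 = zs i.+1 0.
  move=> [|[|[|//]]] _; rewrite /zs.
  - by rewrite boost_path0 mulr1.
  - by rewrite boost_path0.
  - by rewrite boost_path0.
have lift_cs : forall i, (i < 4)%N -> lift_piece (cs i) (zs i).
  by move=> [|[|[|[|//]]]] _; [exact: lift_piece_rescale lg|exact: l1|exact: l2|exact: l3].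
have cs_U : forall i t, (i < 4)%N -> 0 <= t <= 1 -> U (cs i t).
  have gN : `|- g| <= (2 * e)%:C by rewrite normrN.
  have d1 t := boost_path_dist t tz0 e2 be1.
  have d2 t := boost_path_dist t tz1 e2 al1.
  have d3 t := boost_path_dist t tz2 e2' gN.
  have zb : `|sum_map z0 - b| <= (r / 2)%:C by rewrite sz0; exact: rhob.
  move=> [|[|[|[|//]]]] t _ t01; rewrite /cs.
  + apply: c0U; case/andP: t01 => t0' t1'.
    by rewrite mulr_ge0 ?(ltW s0) //= -[leRHS]mulr1 ler_pM // ltW.
  + exact: close _ _ (dist_trans (d1 t) zb) budget1.
  + exact: close _ _ (dist_trans (d2 t) (dist_trans (d1 1) zb)) budget2.
  + exact: close _ _ (dist_trans (d3 t) (dist_trans (d2 1) (dist_trans (d1 1) zb))) budget3.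
have cs_end : cs 3%N 1 = b.
  rewrite /cs -/z3 /sum_map; under eq_bigr => i _ do rewrite z3E.
  by rewrite -mulr_sumr -/(sum_map z0) sz0 /c0 mulrA mulVf ?mul1r // rho_neq0.
have cs_start : cs 0%N 0 = b by rewrite /cs mulr0.
have zs_start : zs 0%N 0 = \val q by rewrite /zs mulr0.
have zE : z3 = \val q.
  exact: (fixed_points_chain m0 Ureg (isT : (0 < 4)%N) smooth_cs match_cs cs_U
    cs_start cs_end lift_cs match_zs zs_start fq).
by rewrite -zE z3E -/z0 mulrA mulfV ?mul1r // rho_neq0.
Qed.

End FixedPoints.

(** * Fixed configurations have two values *)

Section AtMostTwoValues.
Context {R : realType} {m : nat}.
Local Notation C := R[i].
Local Notation V := 'rV[R[i]]_m.
Local Notation Re := complex.Re.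
Local Notation Im := complex.Im.

(** The points z of the circle with ang w z = h lie on a line. *)
Lemma line_meets_circle (w u v p : C) (h : R) : h != 0 ->
  `|u| = 1 -> `|v| = 1 -> `|p| = 1 -> ang w u = h -> ang w v = h -> ang w p = h ->
  u != v -> p = u \/ p = v.
Proof.
move=> h0 u1 v1 p1 uh vh ph uv.
have w0 : Re w ^+ 2 + Im w ^+ 2 != 0.
  apply: contra h0; rewrite paddr_eq0 ?sqr_ge0 // !sqrf_eq0 => /andP[/eqP a /eqP b].
  by rewrite -uh /ang a b !mul0r subrr.
pose T (z : C) := Re w * Re z + Im w * Im z.
have T2 z : `|z| = 1 -> ang w z = h -> T z ^+ 2 = Re w ^+ 2 + Im w ^+ 2 - h ^+ 2.
  move=> /normc_eq1 n <-; rewrite -[X in X - _]mulr1 -n /T /ang; ring.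
have inj y z : ang w y = h -> ang w z = h -> T y = T z -> y = z.
  move=> yh zh yz; apply: complexP; apply: (mulfI w0).
    transitivity (Re w * T y + Im w * ang w y); first by rewrite /T /ang; ring.
    by rewrite yz yh -zh /T /ang; ring.
  transitivity (Im w * T y - Re w * ang w y); first by rewrite /T /ang; ring.
  by rewrite yz yh -zh /T /ang; ring.
have opp y z : `|y| = 1 -> `|z| = 1 -> ang w y = h -> ang w z = h -> y != z -> T y = - T z.
  move=> y1 z1 yh zh; have : T y ^+ 2 = T z ^+ 2 by rewrite !T2.
  by move/eqP; rewrite eqf_sqr => /orP[/eqP /(inj _ _ yh zh) ->|/eqP //]; rewrite eqxx.
have [->|pu] := eqVneq p u; [by left|right].
by apply: inj => //; rewrite (opp p u) // -(opp v u) // eq_sym.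
Qed.

(** The computation of the angular speed of X + i Y, with derivative X' + i Y',
    out of (X + i Y) (1 - i eta t) = (1 + i eta t) (x + i y) and of the derivative
    of this relation with respect to t. *)
Lemma rotation_ang (x y X Y X' Y' eta t a : R) : X ^+ 2 + Y ^+ 2 = 1 ->
  X + eta * t * Y = x - eta * t * y -> Y - eta * t * X = y + eta * t * x ->
  X' + (eta * Y + eta * t * Y') = - (eta * y) ->
  Y' - (eta * X + eta * t * X') = eta * x ->
  X' = - (a * Y) -> Y' = a * X -> a * (1 + (eta * t) ^+ 2) = 2 * eta.
Proof.
move=> n e1 e2 d1 d2 X'E Y'E.
have EX : X' * (1 + (eta * t) ^+ 2) = - (2 * eta * Y).
  transitivity ((X' + (eta * Y + eta * t * Y')) -
    eta * t * (Y' - (eta * X + eta * t * X')) - eta * (Y + eta * t * X)); first by ring.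
  rewrite d1 d2; transitivity (- eta * (y + eta * t * x) - eta * (Y + eta * t * X)).
    by ring.
  by rewrite -e2; ring.
have EY : Y' * (1 + (eta * t) ^+ 2) = 2 * eta * X.
  transitivity ((Y' - (eta * X + eta * t * X')) +
    eta * t * (X' + (eta * Y + eta * t * Y')) + eta * (X - eta * t * Y)); first by ring.
  rewrite d1 d2; transitivity (eta * (x - eta * t * y) + eta * (X - eta * t * Y)).
    by ring.
  by rewrite -e1; ring.
transitivity (Y' * (1 + (eta * t) ^+ 2) * X - X' * (1 + (eta * t) ^+ 2) * Y).
  by rewrite Y'E X'E -[LHS]mulr1 -n; ring.
by rewrite EX EY -[RHS]mulr1 -n; ring.
Qed.

(** Along the rotating lift of [fixed_rotated_lift] all coordinates have the same
    nonzero angular speed, and they are horizontal, so by [line_meets_circle] they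
    take at most two values; at least two values occur by regularity.  The time t is
    taken in the interior of the interval, where the lift coincides with the rotated
    configuration on a neighbourhood. *)
Lemma fixed_two_values (b : C) (U : set C) (q : fiber m b) : (0 < m)%N ->
  open (U : set R[i]^o) -> U `<=` regular_value m -> U b -> fixed_points m b U q ->
  (range (fun j : 'I_m => (\val q : V) ord0 j) #= `I_2)%card.
Proof.
move=> m0 oU Ureg Ub fq.
have [eta [t0 [c [gam [eta0 /andP[t00 t01] lg cU rotE]]]]] :=
  fixed_rotated_lift m0 oU Ureg Ub fq.
pose t := t0 / 2; have tpos : 0 < t by rewrite divr_gt0.
have tt0 : t < t0 by rewrite /t; lra.
have t_itv : 0 <= t <= 1 by rewrite /t; apply/andP; split; lra.
have [tz sz hz] := lg.1 t t_itv.
have g0 : gram (gam t) != 0.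
  by rewrite gt_eqF // regular_gram_gt0 // sz; apply/Ureg/cU.
have vE j := horizontal_spaceE tz g0 hz j.
pose w := control (gam t) (\sum_k (\row_j velocity (fun s => gam s ord0 j) t : V) ord0 k).
have angE j : ang w (gam t ord0 j) * (1 + (eta * t) ^+ 2) = 2 * eta.
  have [A [_ sA smA]] := lg.2.
  have At : A t by apply: sA; rewrite /= in_itv.
  have [dX dY] := is_derive_velocity (smA j) At.
  have := vE j; rewrite mxE -/w => vw; rewrite vw /hvel /= in dX dY.
  pose X s := Re (gam s ord0 j); pose Y s := Im (gam s ord0 j).
  pose x := Re ((\val q : V) ord0 j); pose y := Im ((\val q : V) ord0 j).
  have rel s : 0 < s < t0 -> X s + (eta * s + 0) * Y s = - (eta * y) * s + x /\
      Y s - (eta * s + 0) * X s = eta * x * s + y.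
    move=> /(rotE s j) e; have [d0 _] := rho_den (eta * s).
    have : gam s ord0 j * (1 -i* (eta * s)) = (1 +i* (eta * s)) * (\val q : V) ord0 j.
      by rewrite e /rho mulrAC divfK.
    move=> e'; have := congr1 (@complex.Re R) e'; have := congr1 (@complex.Im R) e'.
    rewrite !complex_ReM !complex_ImM /= -/(X s) -/(Y s) -/x -/y => h2 h1.
    by split; lra.
  have near_t : \near t, 0 < t < t0.
    have : open (`]0, t0[%classic : set R) by exact: interval_open.
    move=> oI; have tI : (`]0, t0[%classic : set R) t by rewrite /= in_itv /= tpos.
    by have := open_nbhs_nbhs (conj oI tI); apply: filterS => s; rewrite /= in_itv.
  have dl := is_derive_affine t eta 0.
  have D1 := is_deriveD1 dX (is_deriveM1 dl dY).
  have D2 := is_deriveB1 dY (is_deriveM1 dl dX).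
  have E1 := is_derive_unique1 (near_eq_is_derive (filterS (fun s h => (rel s h).1) near_t) D1)
    (is_derive_affine t (- (eta * y)) x).
  have E2 := is_derive_unique1 (near_eq_is_derive (filterS (fun s h => (rel s h).2) near_t) D2)
    (is_derive_affine t (eta * x) y).
  have [r1 r2] := rel t (introT andP (conj tpos tt0)).
  apply: (@rotation_ang x y (X t) (Y t) _ _ eta t) (erefl _) (erefl _).
  - exact/normc_eq1/tz.
  - by move: r1; rewrite addr0; lra.
  - by move: r2; rewrite addr0; lra.
  - by rewrite -E1 addr0.
  - by rewrite -E2 addr0.
have den0 : 1 + (eta * t) ^+ 2 != 0 by exact: ramp_den.
have angE' j : ang w (gam t ord0 j) = 2 * eta / (1 + (eta * t) ^+ 2).
  by rewrite -(angE j) mulfK.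
have h0 : 2 * eta / (1 + (eta * t) ^+ 2) != 0.
  by rewrite mulf_neq0 ?invr_eq0 // mulf_neq0 ?gt_eqF.
have rotE' j : gam t ord0 j = rho (eta * t) * (\val q : V) ord0 j.
  by apply: rotE; rewrite tpos.
have inj j k : gam t ord0 j = gam t ord0 k -> (\val q : V) ord0 j = (\val q : V) ord0 k.
  by rewrite !rotE' => /(mulfI (rho_neq0 _)).
have [j [k djk]] := gram_neq0 g0.
have jk : gam t ord0 j != gam t ord0 k.
  by apply/eqP => e; move/eqP: djk; apply; rewrite /det2 e; ring.
apply/card_range2P; exists j, k; split.
  by apply: contra jk; rewrite !rotE' => /eqP ->.
move=> l; have := line_meets_circle h0 (tz j) (tz k) (tz l) (angE' j) (angE' k) (angE' l) jk.
by case=> /inj ->; [left|right].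
Qed.

End AtMostTwoValues.

Theorem proposition7p4 (R : realType) (m : nat) (b : R[i]) (U : set R[i]) :
  (1 <= m)%N ->
  regular_value m b ->
  open (U : set R[i]^o) ->
  U `<=` regular_value m ->
  U b ->
  fixed_points m b U =
    [set z : fiber m b |
      (range (fun j : 'I_m => (\val z : 'rV[R[i]]_m) ord0 j) #= `I_2)%card].
Proof.
move=> m0 _ oU Ureg Ub; apply/seteqP; split=> q.
  exact: fixed_two_values.
exact: two_values_fixed.
Qed.
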